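(* Let $(n_D,q,\alpha)=(3,7,3)$ or $(n_D,q,\alpha)=(4,9,6)$, and let $Q$ be the $n_D$-dimensional toric quantum code with parameters $[[\alpha q,\alpha,d_M=3]]$ associated with the lattice code $A\mathbb{Z}^{n_D}/q\mathbb{Z}^{n_D}$ (that is, $[[21,3,3]]$ for $n_D=3$ and $[[54,6,3]]$ for $n_D=4$). Combining $Q$ with the interleaving technique on the $q^{n_D}$ hypercubic lattice described in the context yields an interleaved toric quantum code with parameters $[[\alpha q^{n_D},\alpha q^{n_D-1},t_i=q]]$, that is, $[[3q^3,3q^2,t_i=q]]$ with $q=7$ for $n_D=3$, and $[[6q^4,6q^3,t_i=q]]$ with $q=9$ for $n_D=4$. Explicitly: the interleaved code has length $\alpha q^{n_D}$, encodes $\alpha q^{n_D-1}$ qubits, and corrects every burst of up to $q$ errors having the shape of the Lee sphere of radius $1$ in the $q^{n_D}$ hypercubic lattice.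
   Context: Notation. $\mathbb{Z}_q=\mathbb{Z}/q\mathbb{Z}$. An $[[n,k,d]]$ quantum code encodes $k$ qubits in $n$ qubits and has minimum distance $d$; it corrects arbitrary errors on up to $t=\lfloor (d-1)/2\rfloor$ qubits. In the notation $[[n,k,t_i]]$ used for interleaved codes, $t_i$ is the (burst) error-correcting capability. Lattice code. For $n_D=3$, $q=7$, $A=\begin{pmatrix}0&2&1\\0&1&4\\1&0&2\end{pmatrix}$; for $n_D=4$, $q=9$, $A=\begin{pmatrix}0&0&1&6\\0&0&-1&3\\0&1&1&1\\1&0&0&2\end{pmatrix}$. $A\mathbb{Z}^{n_D}$ is the lattice generated by the rows of $A$; it contains $q\mathbb{Z}^{n_D}$ and has index $q$ in $\mathbb{Z}^{n_D}$. $\mathcal{C}=A\mathbb{Z}^{n_D}/q\mathbb{Z}^{n_D}\subset\mathbb{Z}_q^{n_D}$ is the set of $q^{n_D-1}$ codewords; it is generated by $(0,1,4),(1,0,2)$ modulo $7$ if $n_D=3$, and by $(0,0,1,6),(0,1,1,1),(1,0,0,2)$ modulo $9$ if $n_D=4$. Cross-section $j$ ($j=0,\dots,q-1$) is the set of points of $\mathbb{Z}_q^{n_D}$ with first coordinate $j$; it contains $q^{n_D-2}$ codewords. The Lee sphere of radius $1$ is $S=\{0,\pm e_1,\dots,\pm e_{n_D}\}\subset\mathbb{Z}_q^{n_D}$, which has $q=2n_D+1$ elements, and $\mathbb{Z}_q^{n_D}$ is the disjoint union of the translates $c+S$, $c\in\mathcal{C}$; so $c+S$ is the fundamental region attached to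 the codeword $c$. Base code $Q$. Identify the Lee sphere of unit (hyper)cubes, a fundamental region of $A\mathbb{Z}^{n_D}$, with the torus $\mathbb{R}^{n_D}/A\mathbb{Z}^{n_D}$ carrying the cubical cell structure induced by $\mathbb{Z}^{n_D}$ (it has $q$ top-dimensional cubes). $Q$ is the standard toric stabilizer code on this torus: qubits correspond to the $\alpha q$ two-dimensional faces; stabilizer generators are, for each edge, the product of $\sigma_x$ over the faces containing that edge, and, for each three-dimensional cube, the product of $\sigma_z$ over the faces in its boundary. Its length is $\alpha q$, its dimension is $k=\alpha$, and its distance is taken to be the minimum Mannheim distance $d_M=3$ of $\mathcal{C}$ (the minimum over nonzero codewords of the sum of the absolute values of the coordinates, with representatives modulo $q$ of smallest absolute value); so $t=1$. Interleaving technique. The $q^{n_D}$ hypercubic lattice $\mathbb{Z}_q^{n_D}$ has $q^{n_D}$ hypercubes and $\alpha q^{n_D}$ two-dimensional faces, which are the qubit positions; $\alpha$ of these positions are attached to each hypercube $x\in\mathbb{Z}_q^{n_D}$. One copy of $Q$ (a block of $\alpha q$ qubits encoding $\alpha$ qubits) is taken for each of the $q^{n_D-1}$ codewords of $\mathcal{C}$; the copies belonging to codewords in cross-section $j$ make up the $\alpha q^{n_D-1}$ qubits of cross-section $j$, listed copy by copy in the order of the codewords of the cross-section given by the generator vectors. Enumerate $S=\{s_0=0,s_1,\dots,s_{q-1}\}$, and enumerate $\mathcal{C}$ by means of the generator vectors, starting with the null codeword. For each $j$, the $\alpha q^{n_D-1}$ qubits of cross-section $j$ are placed on the positions of the hypercubes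 $c+s_j$, $c\in\mathcal{C}$: the list is cut into $\alpha$ consecutive groups of $q^{n_D-1}$ qubits, and the qubits of each group are placed one on each hypercube $c+s_j$, in the order of the enumeration of $\mathcal{C}$. Thus the qubits on the hypercubes $c+s_j$ ($c\in\mathcal{C}$) are exactly those of cross-section $j$. The interleaved code is the resulting code on all $\alpha q^{n_D}$ qubits; decoding consists of deinterleaving (inverting the placement) and then decoding each copy of $Q$ separately. A burst (cluster) of up to $q$ errors having the shape of the Lee sphere of radius $1$ is an error affecting, for some $p\in\mathbb{Z}_q^{n_D}$, at most one qubit of each of the $q$ hypercubes of $p+S$ and no other qubit. *)

(* Defs.v *)
From HB Require Import structures.
From mathcomp Require Import all_boot all_order all_algebra.

Set Implicit Arguments.
Unset Strict Implicit.
Unset Printing Implicit Defensive.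

Import Order.TTheory GRing.Theory Num.Theory.
Local Open Scope ring_scope.

(** * Quantum codes on a finite set of qubits *)

Section QuantumCodes.
Variables (C : numClosedFieldType) (X : finType).

Definition bits : predArgType := {ffun X -> bool}.

(* The Hilbert space of the qubits X; psi b is the amplitude of the
   computational basis vector |b>. *)
Definition state := {ffun bits -> C^o}.

(* An operator M is given by its matrix entries M b b' = <b|M|b'>. *)
Definition operator := bits -> bits -> C.

Definition act (M : operator) (psi : state) : state :=
  [ffun b => \sum_b' M b b' * psi b'].

Fact act_is_linear M : linear (act M).
Proof.
move=> a u v; apply/ffunP => b; rewrite !ffunE /= scaler_sumr -big_split /=.
by apply: eq_bigr => b' _; rewrite !ffunE mulrDr mulrCA.
Qed.

HB.instance Definition _ M :=
  GRing.isLinear.Build C state state _ (act M) (act_is_linear M).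

Definition sigma_x (A : {set X}) : operator :=
  fun b b' => (b == [ffun x => b' x (+) (x \in A)])%:R.

Definition sigma_z (A : {set X}) : operator :=
  fun b b' => (b == b')%:R * (-1) ^+ #|[set x in A | b x]|.

(* The joint +1 eigenspace of all the generators sigma_x (SX i), sigma_z (SZ j);
   the code encodes k qubits when this space has dimension 2 ^ k. *)
Definition stabilizer_code (I J : finType) (SX : I -> {set X}) (SZ : J -> {set X}) :
    {vspace state} :=
  ((\bigcap_(i : I) fixedSpace (linfun (act (sigma_x (SX i))))) :&:
   (\bigcap_(j : J) fixedSpace (linfun (act (sigma_z (SZ j))))))%VS.

(* E acts only on the qubits of T: it is the tensor product of an arbitrary
   operator on T and the identity on the other qubits. *)
Definition supported (T : {set X}) (E : operator) : Prop :=
  (forall b b' : bits, E b b' != 0 -> forall x, x \notin T -> b x = b' x) /\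
  (forall b1 b1' b2 b2' : bits,
     (forall x, x \in T -> b1 x = b2 x /\ b1' x = b2' x) ->
     (forall x, x \notin T -> b1 x = b1' x /\ b2 x = b2' x) ->
     E b1 b1' = E b2 b2').

(* Trace preservation of the quantum operation with Kraus operators R:
   the sum over k of R_k^dagger R_k is the identity. *)
Definition trace_preserving (K : finType) (R : K -> operator) : Prop :=
  forall b1 b2, \sum_k \sum_b (R k b b1)^* * R k b b2 = (b1 == b2)%:R.

(* The operation R maps E rho E^dagger to a multiple of rho, for every rho on
   the code space V and every E acting only on a set of qubits allowed by P. *)
Definition corrects (K : finType) (R : K -> operator) (V : {vspace state})
    (P : {set X} -> Prop) : Prop :=
  trace_preserving R /\
  forall (T : {set X}) (E : operator), P T -> supported T E ->
  forall k, exists lambda : C,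
  forall psi, psi \in V -> act (R k) (act E psi) = lambda *: psi.

End QuantumCodes.

Arguments state C X : clear implicits.
Arguments operator C X : clear implicits.

(** * Placing copies of a code *)

(* Qubit f of copy i is placed at position place (i, f). *)
Section Copies.
Variables (C : numClosedFieldType) (I X Y : finType) (place : I * X -> Y).

Definition copies_code (J1 J2 : finType) (SX : J1 -> {set X}) (SZ : J2 -> {set X}) :
    {vspace state C Y} :=
  stabilizer_code C
    (fun ij : I * J1 => [set place (ij.1, f) | f in SX ij.2])
    (fun ij : I * J2 => [set place (ij.1, f) | f in SZ ij.2]).

Definition copy_bits (b : bits Y) (i : I) : bits X := [ffun f => b (place (i, f))].

(* Undo the placement, then apply the operation R to each copy: the Kraus
   operators are the tensor products of one R_(k i) for each copy i. *)
Definition decode_copies (K : finType) (R : K -> operator C X)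
    (k : {ffun I -> K}) : operator C Y :=
  fun b b' => \prod_i R (k i) (copy_bits b i) (copy_bits b' i).

End Copies.

(** * Lattice codes and their toric codes *)

Record lattice_code := LatticeCode {
  ngens : nat;
  modulus : nat;
  alpha : nat;
  lattice_mx : 'M[int]_ngens.+1;
  gens_mx : 'M[int]_(ngens, ngens.+1)
}.

Definition mx_of_rows m n (s : seq (seq int)) : 'M[int]_(m, n) :=
  \matrix_(i, j) nth 0 (nth [::] s i) j.

Definition lattice_code3 : lattice_code :=
  @LatticeCode 2 7 3
    (mx_of_rows 3 3 [:: [:: 0; 2; 1]; [:: 0; 1; 4]; [:: 1; 0; 2]])
    (mx_of_rows 2 3 [:: [:: 0; 1; 4]; [:: 1; 0; 2]]).

Definition lattice_code4 : lattice_code :=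
  @LatticeCode 3 9 6
    (mx_of_rows 4 4 [:: [:: 0; 0; 1; 6]; [:: 0; 0; -1; 3];
                        [:: 0; 1; 1; 1]; [:: 1; 0; 0; 2]])
    (mx_of_rows 3 4 [:: [:: 0; 0; 1; 6]; [:: 0; 1; 1; 1]; [:: 1; 0; 0; 2]]).

Section Toric.
Variable L : lattice_code.

Definition nD : nat := (ngens L).+1.

Definition cube : predArgType := 'rV['Z_(modulus L)]_nD.

(* The reduction modulo q of the lattice generated by the rows of A. *)
Definition codewords : {set cube} :=
  [set u *m map_mx intr (lattice_mx L) | u : cube].

Definition codeword : predArgType := {c : cube | c \in codewords}.

Definition encode (a : 'rV['Z_(modulus L)]_(ngens L)) : cube :=
  a *m map_mx intr (gens_mx L).

Definition cross_section (x : cube) : 'Z_(modulus L) := x ord0 ord0.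

Definition unit_vec (i : 'I_nD) : cube := delta_mx ord0 i.

Definition lee_sphere : {set cube} :=
  [set x | (x == 0) || [exists i, (x == unit_vec i) || (x == - unit_vec i)]].

Definition mannheim_weight (x : cube) : nat :=
  \sum_i minn (x ord0 i) (modulus L - x ord0 i).

Definition min_mannheim_distance (d : nat) : Prop :=
  (exists c, [/\ c \in codewords, c != 0 & mannheim_weight c = d]) /\
  (forall c, c \in codewords -> c != 0 -> (d <= mannheim_weight c)%N).

Definition directions (k : nat) : predArgType := {I : {set 'I_nD} | #|I| == k}.

(* Since A Z^n contains q Z^n, the vertices Z^n / A Z^n of the torus are the
   cosets of the codewords in Z_q^n. *)
Definition vertices : {set {set cube}} :=
  [set [set x + c | c in codewords] | x : cube].

Definition vertex : predArgType := {B : {set cube} | B \in vertices}.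

(* A k-cell of the torus: the k-dimensional cube with given least corner
   spanned by a set of k coordinate directions. *)
Definition cell (k : nat) : predArgType := (vertex * directions k)%type.

(* The cells contained in the cell with least corner y and directions I are
   those with least corner y + sum_(i in K) e_i and directions J, for disjoint
   subsets J, K of I. *)
Definition incident j k (F : cell j) (G : cell k) : bool :=
  (val F.2 \subset val G.2) &&
  [exists K : {set 'I_nD}, (K \subset val G.2 :\: val F.2) &&
    [exists y in val G.1, y + \sum_(i in K) unit_vec i \in val F.1]].

Definition face : predArgType := cell 2.

Definition edge_star (e : cell 1) : {set face} := [set f : face | incident e f].

Definition cube_boundary (c : cell 3) : {set face} := [set f : face | incident f c].

Definition toric_code (C : numClosedFieldType) : {vspace state C face} :=
  stabilizer_code C edge_star cube_boundary.

(** * Interleaving *)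

(* A two-dimensional face of the lattice Z_q^n, attached to the cube at its
   least corner. *)
Definition position : predArgType := (cube * directions 2)%type.

Section Placement.
Variables (codes spheres : seq cube) (faces : seq face) (slots : seq (directions 2)).

Definition section_qubits (j : 'Z_(modulus L)) : seq (cube * face) :=
  [seq (c, f) | c <- [seq c <- codes | cross_section c == j], f <- faces].

(* Qubit number m of cross-section j goes to the cube c_r + s_j, where
   r = m mod q ^ (n - 1); the group number m / q ^ (n - 1) selects one of the
   alpha positions attached to that cube. The default value f.2 is irrelevant:
   this number is smaller than alpha. *)
Definition placement (cf : codeword * face) : position :=
  let: (c, f) := cf in
  let j := cross_section (val c) in
  let m := index (val c, f) (section_qubits j) in
  let N := (modulus L ^ nD.-1)%N in
  (nth 0 codes (m %% N) + nth 0 spheres j, nth f.2 slots (m %/ N)).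

End Placement.

Definition lee_burst (T : {set position}) : Prop :=
  exists p : cube,
    (forall y, y \in T -> y.1 - p \in lee_sphere) /\
    (forall y z, y \in T -> z \in T -> y.1 = z.1 -> y = z).

End Toric.

(* Main.v *)
(* A parity check h with values in Z_q identifies the vertices of the torus with Z_q and
   maps the Lee sphere bijectively onto Z_q. The cellular complex of the torus modulo 2
   is then a Koszul complex over F_2[Z_q]; as q is odd, it retracts onto its translation
   invariant part by contracting along a direction with h = 1, which leaves one logical
   qubit for each pair of directions. Two different faces have neither the same edges
   nor the same three-dimensional cubes around them, hence the errors on one qubit have
   distinct syndromes and Q corrects them.
   The q cubes p + s of a burst have pairwise different parities, the cubes holding
   cross-section j all have the parity of s_j: the burst hits every copy of Q at most
   once. An error hitting every copy at most once is a combination of tensor products of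
   errors that Q corrects, and decoding copy by copy is a tensor product too. *)
Require Import Defs.
From mathcomp Require Import all_boot all_order all_algebra.
From mathcomp Require Import reals.
From mathcomp Require Import complex.
From HB Require Import structures.
From mathcomp Require Import ring.

Set Implicit Arguments.
Unset Strict Implicit.
Unset Printing Implicit Defensive.

Import Order.TTheory GRing.Theory Num.Theory.
Local Open Scope ring_scope.

(** * Configurations of qubits *)

(** [bool] serves as the field F_2, with exclusive or as [+] and conjunction as [*], so
    configurations form an F_2-vector space and both kinds of generators are expressed through the
    pairing [dot]. States are handled pointwise: a code state vanishes off the kernel of the sigma_z
    syndrome and is constant on the cosets of the span of the sigma_x generators. Dimensions thus
    come from a bijection between cosets and logical labels rather than from ranks. Recovery is
    established as one scalar for each Kraus operator and each elementary error; this form survives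
    both tensor products and linear combinations. As Z_9 is not a field, facts about the lattice
    rest on explicit matrix identities rather than on linear algebra over Z_q. *)

Section Bits.
Variable X : finType.
Implicit Types (b c : bits X) (A : {set X}).

Definition dot b c : bool := \sum_x b x * c x.
Definition ind A : bits X := [ffun x => x \in A].
(** An error on at most one qubit; [None] stands for no error. *)
Definition err (o : option X) : bits X := oapp (fun x => ind [set x]) 0 o.

Lemma bitsE b c x : (b + c) x = b x + c x. Proof. by rewrite ffunE. Qed.

Lemma addbits_self b : b + b = 0.
Proof. by apply/ffunP => x; rewrite !ffunE; apply: addbb. Qed.

Lemma addbitsK b : involutive (+%R^~ b).
Proof. by move=> c; rewrite -addrA addbits_self addr0. Qed.

Lemma eq_addbits b b' c : (b == b' + c) = (b' == b + c).
Proof. by apply/eqP/eqP => ->; rewrite addbitsK. Qed.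

Lemma dotC b c : dot b c = dot c b.
Proof. by apply: eq_bigr => x _; apply: mulrC. Qed.

Lemma dotDr b c c' : dot b (c + c') = dot b c + dot b c'.
Proof. by rewrite -big_split; apply: eq_bigr => x _; rewrite ffunE; apply: mulrDr. Qed.

Lemma dot0r b : dot b 0 = 0.
Proof. by apply: big1 => x _; rewrite ffunE; apply: mulr0. Qed.

Lemma dotDl b b' c : dot (b + b') c = dot b c + dot b' c.
Proof. by rewrite !(dotC _ c) dotDr. Qed.

Lemma dot_ind A b : dot (ind A) b = \sum_(x in A) b x.
Proof.
rewrite big_mkcond; apply: eq_bigr => x _; rewrite ffunE.
by case: (x \in A); [apply: mul1r | apply: mul0r].
Qed.

Lemma dot_err b x : dot b (err (Some x)) = b x.
Proof. by rewrite dotC dot_ind big_set1. Qed.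

(** Links the cardinal in the exponent of [sigma_z] to the F_2 pairing. *)
Lemma dot_parity A b : dot (ind A) b = odd #|[set x in A | b x]|.
Proof.
have odd_sum (s : seq X) (P : pred X) : \sum_(x <- s | P x) b x = odd (\sum_(x <- s | P x) b x)%N.
  elim/big_rec2: _ => // x y ? _ ->; rewrite oddD; congr (_ (+) _); by case: (b x).
rewrite dot_ind odd_sum -sum1_card; congr odd; rewrite big_mkcond [RHS]big_mkcond.
by apply: eq_bigr => x _; rewrite inE; case: (x \in A) (b x) => [] [].
Qed.

End Bits.

(** * Syndromes and spans of generators *)

Section Generators.
Variables (X I : finType) (S : I -> {set X}).
Implicit Types b c : bits X.

Definition synd b : bits I := [ffun i => dot (ind (S i)) b].
Definition xorspan (a : bits I) : bits X := [ffun x => \sum_i a i * (x \in S i)].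

Lemma syndD b c : synd (b + c) = synd b + synd c.
Proof. by apply/ffunP => i; rewrite !ffunE dotDr. Qed.

(** The incidence matrix of the generators and its transpose are adjoint for [dot]. *)
Lemma dot_xorspan b a : dot b (xorspan a) = dot (synd b) a.
Proof.
rewrite /dot (eq_bigr (fun x => \sum_i b x * (a i * (x \in S i)))); last first.
  by move=> x _; rewrite ffunE; apply: mulr_sumr.
rewrite exchange_big; apply: eq_bigr => i _; rewrite ffunE.
rewrite (eq_bigr (fun x => (b x * (x \in S i)) * a i)); last first.
  by move=> x _; rewrite mulrAC mulrA.
rewrite -mulr_suml; congr (_ * _); rewrite dotC; apply: eq_bigr => x _.
by rewrite ffunE.
Qed.

Lemma xorspan_invariant (T : Type) (psi : bits X -> T) :
  (forall i b, psi (b + ind (S i)) = psi b) -> forall a b, psi (b + xorspan a) = psi b.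
Proof.
move=> psi_inv a b.
have -> : xorspan a = \sum_(i | a i) ind (S i).
  apply/ffunP => x; rewrite sum_ffunE ffunE [RHS]big_mkcond.
  by apply: eq_bigr => i _; rewrite ffunE; case: (a i); [apply: mul1r | apply: mul0r].
elim/big_rec: _ b => [b|i c _ IH b]; first by rewrite addr0.
by rewrite addrA IH psi_inv.
Qed.

End Generators.

(** * Signs and character sums over F_2 *)

Section Sign.
Variable C : numClosedFieldType.

Definition sgn (x : bool) : C := (-1) ^+ x.

Lemma sgnD (x y : bool) : sgn (x + y) = sgn x * sgn y.
Proof. exact: signr_addb. Qed.

Lemma sgn_sqr x : sgn x * sgn x = 1.
Proof. by rewrite -sgnD; case: x. Qed.

Lemma sgn_conj x : (sgn x)^* = sgn x.
Proof. by rewrite /sgn rmorph_sign. Qed.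

(** Orthogonality of characters: the sum factors over the coordinates, and a coordinate with
    [s i = 1] contributes 1 - 1. *)
Lemma sum_sgn_dot (I : finType) (s : bits I) :
  \sum_(a : bits I) sgn (dot s a) = (s == 0)%:R * (2 ^ #|I|)%:R.
Proof.
have sgn_sum (a : bits I) : sgn (dot s a) = \prod_i sgn (s i * a i).
  by rewrite /dot (big_morph sgn sgnD (erefl _)).
rewrite (eq_bigr _ (fun a _ => sgn_sum a)).
rewrite -(bigA_distr_bigA (fun i x => sgn (s i * x))).
have sgn_bool (y : bool) : \sum_(x : bool) sgn (y * x) = (~~ y)%:R * 2%:R.
  rewrite big_bool; case: y; rewrite /sgn /= ?expr1 ?expr0 ?mul0r ?mul1r //.
  by rewrite addrC subrr.
rewrite (eq_bigr _ (fun i _ => sgn_bool _)) big_split /= prodr_const natrX.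
congr (_ * _); have [->|/eqP s_neq0] := eqVneq s 0.
  by rewrite big1 // => i _; rewrite ffunE.
have [i si] : exists i, s i.
  apply/existsP; apply: contra_notT s_neq0 => /existsPn s0.
  by apply/ffunP => i; rewrite ffunE; apply/negbTE.
by rewrite (bigD1 i) //= si mul0r.
Qed.

End Sign.
Arguments sgn : clear implicits.

(** * Stabilizer codes and syndrome decoding *)

Section StabilizerCode.
Variables (C : numClosedFieldType) (X I J : finType).
Variables (SX : I -> {set X}) (SZ : J -> {set X}).
Implicit Types b : bits X.

Lemma act_sigma_x A (psi : state C X) b : act (sigma_x C A) psi b = psi (b + ind A).
Proof.
rewrite ffunE (bigD1 (b + ind A)) //= /sigma_x.
have sum_eq (b' : bits X) : (b == [ffun x => b' x (+) (x \in A)]) = (b' == b + ind A).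
  rewrite -eq_addbits; congr (_ == _); apply/ffunP => x; by rewrite !ffunE.
rewrite sum_eq eqxx mul1r big1 ?addr0 // => b' /negbTE b'neq.
by rewrite sum_eq b'neq mul0r.
Qed.

Lemma act_sigma_z A (psi : state C X) b :
  act (sigma_z C A) psi b = sgn C (dot (ind A) b) * psi b.
Proof.
rewrite ffunE (bigD1 b) //= /sigma_z eqxx mul1r dot_parity /sgn signr_odd.
by rewrite big1 ?addr0 // => b' /negbTE b'neq; rewrite eq_sym b'neq !mul0r.
Qed.

(** Where a sigma_z generator has sign -1, being fixed means [- psi b = psi b], so the amplitude
    vanishes; sigma_x generators merely translate the argument. *)
Lemma mem_stabilizer_code (psi : state C X) :
  reflect ((forall i b, psi (b + ind (SX i)) = psi b) /\
           (forall b, psi b != 0 -> synd SZ b = 0))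
          (psi \in stabilizer_code C SX SZ).
Proof.
have fixedP (M : operator C X) :
    (psi \in fixedSpace (linfun (act M))) = (act M psi == psi).
  by apply/fixedSpaceP/eqP; rewrite lfunE.
rewrite memv_cap; apply: (iffP andP) => [[/subv_bigcapP inX /subv_bigcapP inZ]|[inX inZ]].
  split=> [i b|b psi_b].
    by have /eqP {2}<- := etrans (esym (fixedP _)) (inX i isT); rewrite act_sigma_x.
  apply/ffunP => j; have /eqP/ffunP/(_ b) := etrans (esym (fixedP _)) (inZ j isT).
  rewrite act_sigma_z !ffunE; case: dot => // /eqP.
  by rewrite /sgn expr1 mulN1r eqNr (negbTE psi_b).
split; apply/subv_bigcapP => i _; rewrite -memvE fixedP; apply/eqP/ffunP => b.
  by rewrite act_sigma_x.
rewrite act_sigma_z; have [->|/inZ/ffunP/(_ i)] := eqVneq (psi b) 0; first by rewrite mulr0.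
by rewrite !ffunE => ->; apply: mul1r.
Qed.

End StabilizerCode.

Lemma sum_delta (R : pzSemiRingType) (T : finType) (x : T) (F : T -> R) :
  \sum_y (y == x)%:R * F y = F x.
Proof.
by rewrite (bigD1 x) //= eqxx mul1r big1 ?addr0 // => y /negbTE ->; rewrite mul0r.
Qed.

Lemma addbits_eq0 (X : finType) (b c : bits X) : (b + c == 0) = (b == c).
Proof. by rewrite [LHS]eq_sym -eq_addbits add0r eq_sym. Qed.

Section SyndromeDecoder.
Variables (C : numClosedFieldType) (X I J : finType).
Variables (SX : I -> {set X}) (SZ : J -> {set X}).
Implicit Types b : bits X.

(** A syndrome that no single error produces gets the default [None], that is, no correction. The
    decoder must be defined on such outcomes too, since trace preservation sums over all of them. *)
Definition correction (K : finType) (S : K -> {set X}) (s : bits K) : bits X :=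
  err (odflt None [pick o | synd S (err o) == s]).

Lemma correctionK (K : finType) (S : K -> {set X}) (o : option X) :
  injective (fun o => synd S (err o)) -> correction S (synd S (err o)) = err o.
Proof.
move=> inj; rewrite /correction; case: pickP => [o' /eqP/inj -> //|/(_ o)].
by rewrite eqxx.
Qed.

(* Projection onto the syndrome space of [st], followed by the correction. The average
   over [a] is the projection for the sigma_x generators. *)
Definition syndrome_decoder (st : bits I * bits J) : operator C X :=
  fun b b' =>
    sgn C (dot (correction SX st.1) b) * (synd SZ (b + correction SZ st.2) == st.2)%:R *
    ((2 ^ #|I|)%:R^-1 * \sum_(a : bits I)
       sgn C (dot st.1 a) * (b' == b + correction SZ st.2 + xorspan SX a)%:R).

Lemma act_syndrome_decoder s t (psi : state C X) b :
  act (syndrome_decoder (s, t)) psi b =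
    sgn C (dot (correction SX s) b) * (synd SZ (b + correction SZ t) == t)%:R *
    ((2 ^ #|I|)%:R^-1 * \sum_(a : bits I)
       sgn C (dot s a) * psi (b + correction SZ t + xorspan SX a)).
Proof.
rewrite ffunE /syndrome_decoder /=.
under eq_bigr => b' _ do rewrite -mulrA -[_^-1 * _ * _]mulrA mulr_suml.
rewrite -mulr_sumr -mulr_sumr exchange_big; congr (_ * (_ * _)).
apply: eq_bigr => a _; under eq_bigr do rewrite -mulrA.
by rewrite -mulr_sumr sum_delta.
Qed.

(** The corrections are signs and translations, hence unitary and invisible here; what remains is
    that the projections onto the syndrome spaces add up to the identity. *)
Lemma syndrome_decoder_trace_preserving : trace_preserving syndrome_decoder.
Proof.
move=> b1 b2.
(* The matrix of the projection onto the sigma_x syndrome [s]; its entries are real. *)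
pose g s b b' : C := (2 ^ #|I|)%:R^-1 *
  \sum_(a : bits I) sgn C (dot s a) * (b' == b + xorspan SX a)%:R.
have gconj s b b' : (g s b b')^* = g s b b'.
  rewrite /g rmorphM fmorphV rmorph_nat rmorph_sum; congr (_ * _).
  by apply: eq_bigr => a _; rewrite rmorphM /= sgn_conj rmorph_nat.
have decE s t b b' : syndrome_decoder (s, t) b b' = sgn C (dot (correction SX s) b) *
    (synd SZ (b + correction SZ t) == t)%:R * g s (b + correction SZ t) b' by [].
have sum_t s : \sum_t \sum_b (syndrome_decoder (s, t) b b1)^* * syndrome_decoder (s, t) b b2 =
    \sum_b g s b b1 * g s b b2.
  transitivity (\sum_t \sum_b (synd SZ b == t)%:R * (g s b b1 * g s b b2)).
    (* Translating [b] by the correction removes it, and its sign is squared away; each [b] then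
       meets exactly one [t]. *)
    apply: eq_bigr => t _; rewrite (reindex_inj (addIr (correction SZ t))) /=.
    apply: eq_bigr => b _; rewrite !decE addbitsK.
    rewrite 2!rmorphM /= sgn_conj gconj rmorph_nat mulrACA; congr (_ * _).
    by rewrite mulrACA sgn_sqr mul1r -natrM mulnb andbb.
  rewrite exchange_big; apply: eq_bigr => b _.
  by under eq_bigr do rewrite eq_sym; rewrite sum_delta.
have sum_s b : \sum_s g s b b1 * g s b b2 = (2 ^ #|I|)%:R^-1 *
    \sum_a ((b1 == b + xorspan SX a)%:R * (b2 == b + xorspan SX a)%:R).
  pose h1 (a : bits I) : C := (b1 == b + xorspan SX a)%:R.
  pose h2 (a : bits I) : C := (b2 == b + xorspan SX a)%:R.
  (* Summing the characters over [s] kills the terms with [a' != a] and gives back one normalising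
     factor. *)
  transitivity ((2 ^ #|I|)%:R^-1 ^+ 2 *
      \sum_(s : bits I) \sum_(a : bits I) \sum_(a' : bits I) sgn C (dot s (a + a')) * (h1 a * h2 a')).
    rewrite mulr_sumr; apply: eq_bigr => s _; rewrite mulrACA -expr2; congr (_ * _).
    rewrite mulr_suml; apply: eq_bigr => a _; rewrite mulr_sumr; apply: eq_bigr => a' _.
    by rewrite dotDr sgnD mulrACA.
  rewrite exchange_big; under eq_bigr do rewrite exchange_big.
  rewrite expr2 -mulrA; congr (_ * _); rewrite mulr_sumr; apply: eq_bigr => a _.
  transitivity ((2 ^ #|I|)%:R^-1 * \sum_(a' : bits I) (a' == a)%:R * ((2 ^ #|I|)%:R * (h1 a * h2 a'))).
    congr (_ * _); apply: eq_bigr => a' _; rewrite -mulr_suml.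
    under eq_bigr do rewrite dotC; rewrite sum_sgn_dot addbits_eq0 eq_sym; exact: esym (mulrA _ _ _).
  by rewrite sum_delta mulKf // pnatr_eq0 expn_eq0.
rewrite -(pair_bigA _ (fun s t => \sum_b (syndrome_decoder (s, t) b b1)^* * syndrome_decoder (s, t) b b2)) /=.
rewrite (eq_bigr _ (fun s _ => sum_t s)) exchange_big (eq_bigr _ (fun b _ => sum_s b)).
rewrite -mulr_sumr exchange_big /=.
under eq_bigr => a _.
  under eq_bigr => b _ do rewrite eq_addbits.
  rewrite (sum_delta (b1 + xorspan SX a) (fun b => (b2 == b + xorspan SX a)%:R)) addbitsK.
  over.
rewrite sumr_const card_ffun card_bool -[_%:R *+ _]mulr_natl mulKf; first by rewrite eq_sym.
by rewrite pnatr_eq0 expn_eq0.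
Qed.

Definition pauli (x z : bits X) (psi : state C X) : state C X :=
  [ffun b => sgn C (dot z b) * psi (b + x)].

Hypothesis synd_injX : injective (fun o => synd SX (err o)).
Hypothesis synd_injZ : injective (fun o => synd SZ (err o)).

Lemma syndrome_decoder_pauli s t x z :
  exists lambda, forall psi, psi \in stabilizer_code C SX SZ ->
    act (syndrome_decoder (s, t)) (pauli (err x) (err z) psi) = lambda *: psi.
Proof.
(* Only the outcome given by the true syndromes survives: sigma_x generators detect the phase part
   [z], sigma_z generators the flip part [x]. The correction then undoes the error up to the sign
   from moving [z] past [x]. *)
exists ((s == synd SX (err z))%:R * (t == synd SZ (err x))%:R * sgn C (dot (err z) (err x))).
move=> psi /mem_stabilizer_code [inX inZ]; apply/ffunP => b.
rewrite act_syndrome_decoder ffunE.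
transitivity (sgn C (dot (correction SX s) b) * (synd SZ (b + correction SZ t) == t)%:R *
    ((s == synd SX (err z))%:R * (sgn C (dot (err z) (b + correction SZ t)) *
      psi (b + correction SZ t + err x)))).
  congr (_ * _); set c := b + _.
  transitivity ((2 ^ #|I|)%:R^-1 * \sum_a
      (sgn C (dot (err z) c) * psi (c + err x)) * sgn C (dot (s + synd SX (err z)) a)).
    congr (_ * _); apply: eq_bigr => a _.
    rewrite ffunE dotDr !sgnD dot_xorspan addrAC (xorspan_invariant inX) dotDl sgnD; ring.
  rewrite -mulr_sumr sum_sgn_dot addbits_eq0.
  by rewrite mulrCA [_^-1 * _]mulrC mulfK ?pnatr_eq0 ?expn_eq0 // mulrC.
have [->|] := eqVneq s; last by rewrite /= !mul0r mulr0 scale0r.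
have [->|t_neq] := eqVneq t (synd SZ (err x)).
  rewrite !correctionK // /= !mul1r.
  rewrite !addbitsK syndD; have [->|/inZ ->] := eqVneq (psi b) 0; first by rewrite scaler0 !mulr0.
  by rewrite add0r eqxx mulr1 dotDr sgnD !mulrA sgn_sqr mul1r.
rewrite /= mulr0 mul0r scale0r.
set c := b + _; have [->|/inZ] := eqVneq (psi (c + err x)) 0; first by rewrite !mulr0.
move/eqP; rewrite syndD addbits_eq0 => /eqP ->; rewrite eq_sym (negbTE t_neq).
by rewrite mulr0 mul0r.
Qed.

(** The four Pauli operators span the operators on one qubit. *)
Lemma act_supported_single (T : {set X}) (E : operator C X) :
  (#|T| <= 1)%N -> supported T E ->
  exists (o : option X) (coef : bool -> bool -> C), forall psi, act E psi =
    \sum_(x : bool) \sum_(z : bool) coef x z *: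
      pauli (err (if x then o else None)) (err (if z then o else None)) psi.
Proof.
case: (posnP #|T|) => [/eqP|T_gt0 T_le1].
  rewrite cards_eq0 => /eqP -> _ [E_off E_loc].
  (* On no qubit [E] is scalar, locality making all diagonal entries equal. With [None] the four
     Pauli terms coincide, so only one may have a nonzero coefficient. *)
  exists None, (fun x z => if x || z then 0 else E 0 0) => psi; apply/ffunP => b.
  rewrite !big_bool /= !scale0r !add0r !ffunE /err /= addr0 dotC dot0r [sgn _ _]expr0 mul1r.
  rewrite (eq_bigr (fun b' : bits X => (b' == b)%:R * (E 0 0 * psi b'))) ?sum_delta //.
  move=> b' _; have [->|b'_neq] := eqVneq; last first.
    have [->|/E_off E_b] := eqVneq (E b b') 0; first by rewrite !mul0r.
    by case/eqP: b'_neq; apply/ffunP => x; rewrite E_b ?inE.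
  by rewrite mul1r; congr (_ * _); apply: E_loc => x; rewrite ?inE.
have /cards1P [x ->] : #|T| == 1%N by rewrite eqn_leq T_le1.
move=> [E_off E_loc]; pose e := err (Some x).
have ex : e x = true by rewrite ffunE inE eqxx.
have e_off y : y \notin [set x] -> e y = false by rewrite ffunE => /negbTE.
pose bit (v : bool) : bits X := if v then e else 0.
have bitx v : bit v x = v by case: v; rewrite ?ex // ffunE.
have bit_off v y : y \notin [set x] -> bit v y = 0 by case: v => [/e_off //|]; rewrite ffunE.
pose F (y v : bool) := E (bit v) (bit v + bit y).
have E_F b y : E b (b + bit y) = F y (b x).
  apply: E_loc => w; first by move/set1P ->; rewrite !bitsE !bitx.
  by move=> w_x; rewrite !bitsE !(bit_off _ _ w_x); case: (b w).
(* Fourier inversion on F_2: for a fixed flip [y], the entry as a function of the value of the qubit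
   is a combination of the characters 1 and [sgn]. *)
exists (Some x), (fun y z => 2^-1 * (F y false + sgn C z * F y true)) => psi.
apply/ffunP => b.
transitivity (\sum_y F y (b x) * psi (b + bit y)).
  transitivity (\sum_(b' : bits X) \sum_(y : bool) (b' == b + bit y)%:R * (F y (b x) * psi b')).
    rewrite ffunE; apply: eq_bigr => b' _; rewrite !big_bool /=.
    have bit_neq : b + bit true != b + bit false.
      by apply/eqP => /addrI/ffunP/(_ x); rewrite !bitx.
    have [->|b'1] := eqVneq b' (b + bit true).
      by rewrite (negbTE bit_neq) mul1r mul0r addr0 E_F.
    have [->|b'0] := eqVneq b' (b + bit false); first by rewrite E_F mul0r add0r mul1r.
    rewrite !mul0r addr0; have [->|/E_off E_b] := eqVneq (E b b') 0; first by rewrite mul0r.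
    have : b' = b + bit (b x + b' x).
      apply/ffunP => w; rewrite bitsE; have [->|w_x] := eqVneq w x.
        by rewrite bitx addrA -[in RHS](bitsE b b) addbits_self ffunE add0r.
      by rewrite bit_off ?inE // addr0 E_b ?inE.
    by case: (b x + b' x) => b'E; [rewrite b'E eqxx in b'1|rewrite b'E eqxx in b'0].
  by rewrite exchange_big; apply: eq_bigr => y _; rewrite sum_delta.
have errE y : err (if y then Some x else None) = bit y by case: y.
rewrite sum_ffunE; apply: eq_bigr => y _; rewrite sum_ffunE big_bool !ffunE !errE /=.
rewrite dotC dot_err [dot (err None) b]dotC dot0r.
rewrite /GRing.scale /=; have nz2 : 2 != 0 :> C by rewrite pnatr_eq0.
by case: (b x); rewrite /sgn /= ?expr0 ?expr1; field.
Qed.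

Lemma syndrome_decoder_corrects :
  corrects syndrome_decoder (stabilizer_code C SX SZ) (fun T => #|T| <= 1)%N.
Proof.
split=> [|T E T_le1 E_T [s t]]; first exact: syndrome_decoder_trace_preserving.
have [o [coef actE]] := act_supported_single T_le1 E_T.
have /fin_all_exists2 [lam _ lamP] (xz : bool * bool) : exists2 l : C, True &
    forall psi, psi \in stabilizer_code C SX SZ -> act (syndrome_decoder (s, t))
      (pauli (err (if xz.1 then o else None)) (err (if xz.2 then o else None)) psi) = l *: psi.
  have [l lP] := syndrome_decoder_pauli s t (if xz.1 then o else None)
    (if xz.2 then o else None).
  by exists l.
exists (\sum_x \sum_z coef x z * lam (x, z)) => psi psiV.
rewrite actE linear_sum scaler_suml; apply: eq_bigr => x _.
rewrite linear_sum scaler_suml; apply: eq_bigr => z _.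
by rewrite linearZ_LR /= -scalerA -(lamP (x, z) _ psiV).
Qed.

End SyndromeDecoder.

(** * Dimension of a stabilizer code *)

Section Dimension.
Variables (C : numClosedFieldType) (X I J T : finType).
Variables (SX : I -> {set X}) (SZ : J -> {set X}).

(* A certificate that [l] classifies the cosets of the span of the [SX i] in the
   configurations satisfying every [SZ j]. *)
Record logical_basis (l : bits X -> T) (w : T -> bits X) (P : bits X -> bits I) : Prop :=
  LogicalBasis {
    synd_generator : forall i, synd SZ (ind (SX i)) = 0;
    logical_generator : forall i b, l (b + ind (SX i)) = l b;
    synd_section : forall t, synd SZ (w t) = 0;
    logical_section : cancel w l;
    section_logical : forall b, synd SZ b = 0 -> w (l b) = b + xorspan SX (P b) }.

Variables (l : bits X -> T) (w : T -> bits X) (P : bits X -> bits I).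
Hypothesis lwP : logical_basis l w P.

Definition spread (phi : {ffun T -> C^o}) : state C X :=
  [ffun b => (synd SZ b == 0)%:R * phi (l b)].

Fact spread_is_linear : linear spread.
Proof.
move=> a u v; apply/ffunP => b; rewrite !ffunE mulrDr; congr (_ + _).
exact: mulrCA.
Qed.

HB.instance Definition _ :=
  GRing.isLinear.Build C {ffun T -> C^o} (state C X) _ spread spread_is_linear.

(** [spread] is an isomorphism from the functions on [T] onto the code; its inverse evaluates a
    state at the representatives [w t]. *)
Lemma dim_stabilizer_code : \dim (stabilizer_code C SX SZ) = #|T|.
Proof.
have spreadK t phi : spread phi (w t) = phi t.
  by rewrite ffunE (synd_section lwP) eqxx mul1r (logical_section lwP).
have -> : stabilizer_code C SX SZ = limg (linfun spread).
  apply/vspaceP => psi; apply/mem_stabilizer_code/memv_imgP => [[inX inZ]|[phi _ ->]].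
    exists [ffun t => psi (w t)]; first exact: memvf.
    rewrite lfunE; apply/ffunP => b; rewrite !ffunE.
    case: eqP => [b0|b_neq0].
      by rewrite (section_logical lwP b0) (xorspan_invariant inX) mul1r.
    by rewrite mul0r; have [|/inZ] := eqVneq (psi b) 0.
  rewrite lfunE; split=> [i b|b].
    by rewrite !ffunE syndD (synd_generator lwP) addr0 (logical_generator lwP).
  by rewrite ffunE; case: (synd SZ b =P 0) => // _; rewrite mul0r eqxx.
have ker0 : lker (linfun spread) = 0%VS.
  apply/eqP; rewrite -subv0; apply/subvP => phi.
  rewrite memv_ker lfunE memv0 => /eqP spread0.
  by apply/eqP/ffunP => t; rewrite -spreadK [spread _]spread0 !ffunE.
by rewrite limg_dim_eq ?ker0 ?capv0 // dimvf /dim /= muln1.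
Qed.

End Dimension.

(** * Decoding copies of a code separately *)

Section Operators.
Variables (C : numClosedFieldType) (X : finType).
Implicit Types (M N : operator C X).

Definition opmul M N : operator C X := fun b b' => \sum_c M b c * N c b'.
Definition op1 : operator C X := fun b b' => (b' == b)%:R.

Lemma eq_act M N : M =2 N -> act M =1 act N.
Proof. by move=> MN psi; apply/ffunP => b; rewrite !ffunE; under eq_bigr do rewrite MN. Qed.

Lemma act_opmul M N psi : act (opmul M N) psi = act M (act N psi).
Proof.
apply/ffunP => b; rewrite !ffunE; under eq_bigr do rewrite mulr_suml.
rewrite exchange_big; apply: eq_bigr => c _; rewrite ffunE mulr_sumr.
by apply: eq_bigr => b' _; rewrite mulrA.
Qed.

Lemma act_op1 psi : act op1 psi = psi.
Proof. by apply/ffunP => b; rewrite ffunE sum_delta. Qed.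

Lemma opmul1r M : opmul M op1 =2 M.
Proof.
move=> b b'; rewrite /opmul /op1; under eq_bigr => c _ do rewrite mulrC eq_sym.
exact: sum_delta.
Qed.

Lemma opmul1l M : opmul op1 M =2 M.
Proof. by move=> b b'; apply: sum_delta. Qed.

End Operators.
Arguments op1 : clear implicits.

Lemma prod_natr_bool (R : comPzSemiRingType) (I : finType) (P : pred I) :
  \prod_i (P i)%:R = [forall i, P i]%:R :> R.
Proof.
case: (boolP [forall i, P i]) => [/forallP allP|].
  by rewrite big1 // => i _; rewrite allP.
by rewrite negb_forall => /existsP [i /negbTE nP]; rewrite (bigD1 i) //= nP mul0r.
Qed.

(** * Copies glued along a bijective placement *)

Section Interleaving.
Variables (C : numClosedFieldType) (I X Y : finType) (place : I * X -> Y) (unplace : Y -> I * X).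
Hypotheses (placeK : cancel place unplace) (unplaceK : cancel unplace place).
Implicit Types b : bits Y.

Local Notation copy := (copy_bits place).

Definition glue (g : {ffun I -> bits X}) : bits Y :=
  [ffun y => g (unplace y).1 (unplace y).2].

Lemma copy_glue g i : copy (glue g) i = g i.
Proof. by apply/ffunP => x; rewrite !ffunE placeK. Qed.

Lemma eq_copies b c : copy b =1 copy c -> b = c.
Proof.
move=> eq_bc; apply/ffunP => y; have /ffunP/(_ (unplace y).2) := eq_bc (unplace y).1.
by rewrite !ffunE -surjective_pairing unplaceK.
Qed.

Lemma copiesD b c i : copy (b + c) i = copy b i + copy c i.
Proof. by apply/ffunP => x; rewrite !ffunE. Qed.

Lemma sum_prod_copies (F : I -> bits X -> C) :
  \sum_b \prod_i F i (copy b i) = \prod_i \sum_c F i c.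
Proof.
rewrite bigA_distr_bigA (reindex glue); last first.
  exists (fun b => [ffun i => copy b i]) => [g _|b _].
    by apply/ffunP => i; rewrite ffunE copy_glue.
  by apply: eq_copies => i; rewrite copy_glue ffunE.
by apply: eq_bigr => g _; apply: eq_bigr => i _; rewrite copy_glue.
Qed.

Definition replace b j (c : bits X) : bits Y :=
  glue [ffun i => if i == j then c else copy b i].

Lemma copy_replace b j c i : copy (replace b j c) i = if i == j then c else copy b i.
Proof. by rewrite copy_glue ffunE. Qed.

Definition tensor (M : I -> operator C X) : operator C Y :=
  fun b b' => \prod_i M i (copy b i) (copy b' i).

Lemma tensor_opmul (M N : I -> operator C X) :
  opmul (tensor M) (tensor N) =2 tensor (fun i => opmul (M i) (N i)).
Proof.
move=> b b'; rewrite /tensor /opmul -sum_prod_copies.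
by apply: eq_bigr => c _; rewrite -big_split.
Qed.

Lemma tensor1 : tensor (fun=> op1 C X) =2 op1 C Y.
Proof.
move=> b b'; rewrite /tensor prod_natr_bool /op1; congr (nat_of_bool _)%:R.
by apply/forallP/eqP => [eq_bb'|-> //]; apply: eq_copies => i; apply/eqP.
Qed.

Section Code.
Variables (J1 J2 : finType) (SX : J1 -> {set X}) (SZ : J2 -> {set X}).
Local Notation SXs := (fun ij : I * J1 => [set place (ij.1, f) | f in SX ij.2]).
Local Notation SZs := (fun ij : I * J2 => [set place (ij.1, f) | f in SZ ij.2]).

Lemma copy_ind (A : {set X}) j i :
  copy (ind [set place (j, x) | x in A]) i = if i == j then ind A else 0.
Proof.
apply/ffunP => x; rewrite !ffunE; have [->|i_neq] := eqVneq; rewrite ffunE.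
  by rewrite mem_imset // => x1 x2 /(can_inj placeK) [].
by apply/negbTE/imsetP => -[x' _ /(can_inj placeK) [ij]]; rewrite ij eqxx in i_neq.
Qed.

Lemma synd_copies b i j : synd SZs b (i, j) = synd SZ (copy b i) j.
Proof.
rewrite !ffunE !dot_ind /= big_imset //=; last by move=> x1 x2 _ _ /(can_inj placeK) [].
by apply: eq_bigr => x _; rewrite ffunE.
Qed.

Lemma synd_copies_eq0 b : synd SZs b = 0 <-> forall i, synd SZ (copy b i) = 0.
Proof.
split=> [b0 i|b0]; apply/ffunP.
  by move=> j; rewrite -synd_copies b0 !ffunE.
by case=> i j; rewrite synd_copies b0 !ffunE.
Qed.

Lemma copy_xorspan a i : copy (xorspan SXs a) i = xorspan SX [ffun j => a (i, j)].
Proof.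
apply/ffunP => x; rewrite !ffunE.
transitivity (\sum_i' \sum_j a (i', j) * (place (i, x) \in [set place (i', f) | f in SX j])).
  by rewrite pair_bigA; apply: eq_bigr => -[].
rewrite (bigD1 i) //= [X in _ + X]big1 ?addr0.
  apply: eq_bigr => j _; rewrite ffunE; congr (_ * _).
  by have /ffunP/(_ x) := copy_ind (SX j) i i; rewrite eqxx !ffunE.
move=> i' i'_neq; apply: big1 => j _.
have /ffunP/(_ x) := copy_ind (SX j) i' i; rewrite eq_sym (negbTE i'_neq) !ffunE => ->.
exact: mulr0.
Qed.

(** Generators of different copies have disjoint supports, so every clause is checked copy by copy.
    The labels become [{ffun I -> T}], which multiplies the number of logical qubits by the number
    of copies. *)
Lemma copies_logical_basis (T : finType) (l : bits X -> T) w P :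
  logical_basis SX SZ l w P ->
  logical_basis SXs SZs (fun b => [ffun i => l (copy b i)])
    (fun t : {ffun I -> T} => glue [ffun i => w (t i)])
    (fun b => [ffun ij => P (copy b ij.1) ij.2]).
Proof.
case=> synd_gen l_gen synd_w lw wl; split.
- case=> i j; apply/synd_copies_eq0 => i'; rewrite copy_ind /=.
  case: eqP => // _; apply/ffunP => j'; rewrite !ffunE; exact: dot0r.
- case=> i j b; apply/ffunP => i'; rewrite !ffunE copiesD copy_ind /=.
  by case: eqP => // _; rewrite addr0.
- by move=> t; apply/synd_copies_eq0 => i; rewrite copy_glue ffunE.
- by move=> t; apply/ffunP => i; rewrite ffunE copy_glue ffunE.
move=> b /synd_copies_eq0 b0; apply: eq_copies => i.
rewrite copy_glue !ffunE wl // copiesD copy_xorspan; congr (_ + xorspan _ _).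
by apply/ffunP => j; rewrite !ffunE.
Qed.

(** Freezing all copies but [j] at the values of [b] turns [psi] into a state of the code on one
    copy, which [M] multiplies by [lambda]. *)
Lemma tensor1_scalar (M : operator C X) j lambda psi :
  (forall phi, phi \in stabilizer_code C SX SZ -> act M phi = lambda *: phi) ->
  psi \in copies_code C place SX SZ ->
  act (tensor (fun i => if i == j then M else op1 C X)) psi = lambda *: psi.
Proof.
move=> M_scalar /mem_stabilizer_code [inX inZ]; apply/ffunP => b.
pose phi : state C X := [ffun c => psi (replace b j c)].
have phiV : phi \in stabilizer_code C SX SZ.
  apply/mem_stabilizer_code; split=> [i c|c]; rewrite !ffunE.
    rewrite -[RHS](inX (j, i)); congr (psi _); apply: eq_copies => i'.
    by rewrite copiesD !copy_replace copy_ind; case: eqP; rewrite ?addr0.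
  by move/inZ/synd_copies_eq0/(_ j); rewrite copy_replace eqxx.
have replace_copy : replace b j (copy b j) = b.
  by apply: eq_copies => i; rewrite copy_replace; case: eqP => // ->.
have /ffunP/(_ (copy b j)) := M_scalar _ phiV; rewrite !ffunE replace_copy => <-.
transitivity (\sum_b' \sum_c (b' == replace b j c)%:R * (M (copy b j) c * psi b')).
  apply: eq_bigr => b' _.
  (* A redundant sum over [c = copy b' j] is inserted, so that exchanging the sums leaves only the
     configurations [replace b j c]. *)
  rewrite (eq_bigr (fun c => (c == copy b' j)%:R *
    ((b' == replace b j c)%:R * (M (copy b j) c * psi b')))); last first.
    move=> c _; have [->|b'_neq] := eqVneq b'; last by rewrite !mul0r mulr0.
    by rewrite copy_replace !eqxx [RHS]mul1r.
  rewrite sum_delta mulrA; congr (_ * _); rewrite /tensor (bigD1 j) //= eqxx mulrC.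
  rewrite (eq_bigr (fun i => (copy b' i == copy b i)%:R)); last first.
    by move=> i /negbTE ->.
  congr (_ * _); rewrite big_mkcond.
  rewrite (eq_bigr (fun i => ((i != j) ==> (copy b' i == copy b i))%:R)); last first.
    by move=> i _; case: ifP.
  rewrite prod_natr_bool; congr (nat_of_bool _)%:R; apply/forallP/eqP => [eq_b|-> i].
    apply: eq_copies => i; rewrite copy_replace; have [->//|i_neq] := eqVneq.
    by have := eq_b i; rewrite i_neq => /eqP.
  by rewrite copy_replace; case: (i == j) => /=.
by rewrite exchange_big; apply: eq_bigr => c _; rewrite sum_delta ffunE.
Qed.

(** The tensor product is a product of operators acting on one copy each. Every factor returns a
    multiple of [psi], so the next one still acts on a code state. *)
Lemma tensor_scalar (M : I -> operator C X) (lambda : I -> C) psi :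
  (forall i phi, phi \in stabilizer_code C SX SZ -> act (M i) phi = lambda i *: phi) ->
  psi \in copies_code C place SX SZ ->
  act (tensor M) psi = (\prod_i lambda i) *: psi.
Proof.
move=> M_scalar psiV.
have tensor_seq (s : seq I) : uniq s ->
    act (tensor (fun i => if i \in s then M i else op1 C X)) psi = (\prod_(i <- s) lambda i) *: psi.
  elim: s => [_|j s IH /= /andP [j_s s_uniq]].
    by rewrite big_nil scale1r (eq_act tensor1) act_op1.
  pose M1 i : operator C X := if i == j then M i else op1 C X.
  pose Ms i : operator C X := if i \in s then M i else op1 C X.
  have MsE : tensor (fun i => if i \in j :: s then M i else op1 C X) =2 opmul (tensor M1) (tensor Ms).
    move=> b b'; rewrite tensor_opmul; apply: eq_bigr => i _; rewrite inE /M1 /Ms.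
    by have [->|] := eqVneq; rewrite ?(negbTE j_s) /= ?opmul1r ?opmul1l.
  have M1E : tensor M1 =2 tensor (fun i => if i == j then M j else op1 C X).
    by move=> b b'; apply: eq_bigr => i _; rewrite /M1; case: eqP => [->|].
  rewrite (eq_act MsE) act_opmul IH // linearZ_LR /= (eq_act M1E).
  by rewrite (tensor1_scalar j (M_scalar j) psiV) scalerA big_cons mulrC.
have := tensor_seq (index_enum I) (index_enum_uniq I); rewrite -/(index_enum I) => <-.
by apply: eq_act => b b'; apply: eq_bigr => i _; rewrite mem_index_enum.
Qed.

Lemma decode_copies_trace_preserving (K : finType) (D : K -> operator C X) :
  trace_preserving D -> trace_preserving (decode_copies place D).
Proof.
move=> D_tp b1 b2.
transitivity (\sum_(k : {ffun I -> K}) \prod_i \sum_c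
    (D (k i) c (copy b1 i))^* * D (k i) c (copy b2 i)).
  apply: eq_bigr => k _; rewrite -sum_prod_copies; apply: eq_bigr => b _.
  by rewrite rmorph_prod -big_split.
rewrite -(bigA_distr_bigA (fun i k => \sum_c (D k c (copy b1 i))^* * D k c (copy b2 i))).
rewrite (eq_bigr _ (fun i _ => D_tp _ _)) prod_natr_bool; congr (nat_of_bool _)%:R.
by apply/forallP/eqP => [eq_b|-> //]; apply: eq_copies => i; apply/eqP.
Qed.

(** * Expansion of an error in matrix units *)

Section MatrixUnits.
Variable T : {set Y}.

Definition in_copy i : {set X} := [set x | place (i, x) \in T].

(* The matrix unit |u><v| on the qubits of [T] in copy [i]. *)
Definition unit_on i (u v : bits X) : operator C X := fun (b b' : bits X) =>
  [forall x, if x \in in_copy i then (b x == u x) && (b' x == v x) else b x == b' x]%:R.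

Lemma supported_unit_on i u v : supported (in_copy i) (unit_on i u v).
Proof.
split=> [b b'|b1 b1' b2 b2' b12 b1_b2]; rewrite /unit_on.
  case: forallP => [eq_b _ x x_T|]; last by rewrite eqxx.
  by have := eq_b x; rewrite (negbTE x_T) => /eqP.
congr (nat_of_bool _)%:R; apply: eq_forallb => x; case: ifP => x_T.
  by have [-> ->] := b12 x x_T.
by have [|-> ->] := b1_b2 x; rewrite ?x_T ?eqxx.
Qed.

Definition on_T b : bits Y := [ffun y => b y && (y \in T)].

(** Requiring [u] and [v] to vanish outside [T] selects one representative for each pair of values
    on [T]; otherwise the same matrix unit would be counted many times. *)
Lemma tensor_unit_on u v b b' :
  ((on_T u == u) && (on_T v == v))%:R * tensor (fun i => unit_on i (copy u i) (copy v i)) b b' =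
  (u == on_T b)%:R * ((v == on_T b')%:R * [forall y, (y \notin T) ==> (b y == b' y)]%:R).
Proof.
rewrite /tensor prod_natr_bool -!natrM !mulnb; congr (nat_of_bool _)%:R.
apply/andP/and3P => [[/andP [/eqP uT /eqP vT] /forallP tens]|[/eqP-> /eqP-> /forallP eq_b]].
  have eq_y y : if y \in T then (b y == u y) && (b' y == v y) else b y == b' y.
    have /forallP/(_ (unplace y).2) := tens (unplace y).1.
    by rewrite inE !ffunE -surjective_pairing unplaceK.
  split.
  - apply/eqP/ffunP => y; rewrite -uT !ffunE; have := eq_y y.
    by case: (y \in T) => [/andP [/eqP-> _]|]; rewrite ?andbF.
  - apply/eqP/ffunP => y; rewrite -vT !ffunE; have := eq_y y.
    by case: (y \in T) => [/andP [_ /eqP->]|]; rewrite ?andbF.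
  by apply/forallP => y; apply/implyP => /negbTE yT; have := eq_y y; rewrite yT.
have on_TK c : on_T (on_T c) = on_T c by apply/ffunP => y; rewrite !ffunE -andbA andbb.
split; first by rewrite !on_TK !eqxx.
apply/forallP => i; apply/forallP => x; rewrite inE !ffunE; have := eq_b (place (i, x)).
by case: (place (i, x) \in T); rewrite ?andbT ?eqxx.
Qed.

Lemma supported_units (E : operator C Y) : supported T E -> exists coef : bits Y -> bits Y -> C,
  E =2 fun b b' => \sum_u \sum_v coef u v * tensor (fun i => unit_on i (copy u i) (copy v i)) b b'.
Proof.
(* By locality the coefficient of a matrix unit may be read off at the representatives that vanish
   outside [T]. *)
move=> [E_off E_loc]; exists (fun u v => E u v * ((on_T u == u) && (on_T v == v))%:R) => b b'.
under eq_bigr => u _ do under eq_bigr => v _ do rewrite -mulrA tensor_unit_on mulrCA.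
under eq_bigr => u _ do rewrite -mulr_sumr; rewrite sum_delta.
under eq_bigr => v _ do rewrite mulrCA; rewrite sum_delta.
case: forallP => [eq_b|neq_b]; rewrite ?mulr1 ?mulr0.
  apply: E_loc => y yT; first by rewrite !ffunE yT !andbT.
  by rewrite !ffunE (negbTE yT) !andbF; have := eq_b y; rewrite yT => /eqP.
apply/eqP; apply: contra_notT neq_b => /E_off eq_b y; apply/implyP => yT.
by rewrite eq_b.
Qed.

End MatrixUnits.

(** Since [corrects] covers every operator supported on an allowed set, it applies to the matrix
    units themselves, whatever [P] is. *)
Lemma decode_copies_corrects (K : finType) (D : K -> operator C X) (P : {set X} -> Prop) :
  corrects D (stabilizer_code C SX SZ) P ->
  corrects (decode_copies place D) (copies_code C place SX SZ)
    (fun T => forall i, P (in_copy T i)).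
Proof.
move=> [D_tp D_corr]; split; first exact: decode_copies_trace_preserving.
move=> T E PT /supported_units [coef E_coef] k.
pose Euv (uv : bits Y * bits Y) := tensor (fun i => unit_on T i (copy uv.1 i) (copy uv.2 i)).
have /fin_all_exists [lam lamP] (uv : bits Y * bits Y) : exists l : C,
    forall psi, psi \in copies_code C place SX SZ ->
    act (decode_copies place D k) (act (Euv uv) psi) = l *: psi.
  have /fin_all_exists [l lP] i : exists l : C, forall phi, phi \in stabilizer_code C SX SZ ->
      act (opmul (D (k i)) (unit_on T i (copy uv.1 i) (copy uv.2 i))) phi = l *: phi.
    have [l lP] := D_corr _ _ (PT i) (supported_unit_on T i (copy uv.1 i) (copy uv.2 i)) (k i).
    by exists l => phi /lP; rewrite act_opmul.
  exists (\prod_i l i) => psi psiV; rewrite -(tensor_scalar lP psiV) -act_opmul.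
  exact: eq_act (tensor_opmul _ _) _.
exists (\sum_u \sum_v coef u v * lam (u, v)) => psi psiV.
have -> : act E psi = \sum_u \sum_v coef u v *: act (Euv (u, v)) psi.
  apply/ffunP => b; rewrite sum_ffunE ffunE.
  transitivity (\sum_b' \sum_u \sum_v coef u v * (Euv (u, v) b b' * psi b')).
    apply: eq_bigr => b' _; rewrite E_coef mulr_suml; apply: eq_bigr => u _.
    by rewrite mulr_suml; apply: eq_bigr => v _; rewrite mulrA.
  rewrite exchange_big; apply: eq_bigr => u _; rewrite exchange_big sum_ffunE.
  by apply: eq_bigr => v _; rewrite !ffunE -mulr_sumr.
rewrite linear_sum scaler_suml; apply: eq_bigr => u _.
rewrite linear_sum scaler_suml; apply: eq_bigr => v _.
by rewrite linearZ_LR /= -scalerA -(lamP (u, v) _ psiV).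
Qed.

End Code.
End Interleaving.

(** Covering separates an error from no error. Separation of two errors is asked in one-sided form,
    because an inclusion of stars already identifies the cells of the torus. *)
Lemma synd_err_inj (X I : finType) (S : I -> {set X}) :
  (forall x, exists i, x \in S i) ->
  (forall x y, (forall i, x \in S i -> y \in S i) -> x = y) ->
  injective (fun o => synd S (err o)).
Proof.
move=> cover sep.
have syndE x i : synd S (err (Some x)) i = (x \in S i) by rewrite ffunE dot_err ffunE.
have synd0 i : synd S (err None) i = false by rewrite ffunE dot0r.
case=> [x|] [y|] // /ffunP eq_synd.
- by congr Some; apply: sep => i; rewrite -!syndE eq_synd.
- by have [i xi] := cover x; move: xi; rewrite -syndE eq_synd synd0.
by have [i yi] := cover y; move: yi; rewrite -syndE -eq_synd synd0.
Qed.

(** * The torus of a lattice code *)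

Section Lattice.
Variable L : lattice_code.
Local Notation q := (modulus L).
Local Notation n := (nD L).
Local Notation Zq := 'Z_(modulus L).
Implicit Types (x y : cube L) (v : Zq) (A : {set 'I_n}).

Lemma card_D1 (T : finType) (A : {set T}) i k : i \in A -> #|A| = k.+1 -> #|A :\ i| = k.
Proof. by move=> iA; rewrite (cardsD1 i) iA add1n => -[]. Qed.

Section Parity.
Variable h : 'I_n -> Zq.

Definition parity x : Zq := \sum_i x ord0 i * h i.

Lemma parity_is_additive : additive parity.
Proof. by move=> x y; rewrite -sumrB; apply: eq_bigr => i _; rewrite !mxE mulrBl. Qed.

HB.instance Definition _ := GRing.isZmodMorphism.Build (cube L) Zq parity parity_is_additive.

Lemma parityZ a i : parity (a *: unit_vec i) = a * h i.
Proof.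
rewrite /parity (bigD1 i) //= !mxE !eqxx mulr1 big1 ?addr0 // => j /negbTE j_neq.
by rewrite !mxE j_neq andbF mulr0 mul0r.
Qed.

Lemma parity_unit_vec i : parity (unit_vec i) = h i.
Proof. by rewrite -[unit_vec i]scale1r parityZ mul1r. Qed.

(* Since the Lee sphere has [q] elements, [h_inj] and [h_neq_opp] say that [parity]
   maps it bijectively onto [Z_q]. *)
Record parity_check : Prop := ParityCheck {
  modulusE : q = n.*2.+1;
  h_inj : injective h;
  h_neq_opp : forall i j, h i != - h j;
  h_last : h ord_max = 1;
  codewordsE : forall x, (x \in codewords L) = (parity x == 0) }.

Hypothesis hP : parity_check.

Lemma h_neq0 i : h i != 0.
Proof. by apply/eqP => hi0; have /eqP[] := h_neq_opp hP i i; rewrite hi0 oppr0. Qed.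

Lemma card_Zq : #|{: Zq}| = q.
Proof. by rewrite card_ord Zp_cast // (modulusE hP). Qed.

Definition lee_vec (o : option (bool * 'I_n)) : cube L :=
  if o is Some (s, i) then (if s then - unit_vec i else unit_vec i) else 0.

Lemma lee_sphereP x : reflect (exists o, x = lee_vec o) (x \in lee_sphere L).
Proof.
rewrite inE; apply: (iffP orP) => [[/eqP->|/existsP[i /orP[]/eqP->]]|[[[[] i]|] ->]].
- by exists None.
- by exists (Some (false, i)).
- by exists (Some (true, i)).
- by right; apply/existsP; exists i; rewrite eqxx orbT.
- by right; apply/existsP; exists i; rewrite eqxx.
by left.
Qed.

Lemma parity_lee_vec_inj : injective (parity \o lee_vec).
Proof.
move=> [[s i]|] [[t j]|] //=; rewrite ?raddf0.
- case: s t => [] []; rewrite ?raddfN /= !parity_unit_vec.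
  + by move/oppr_inj/(h_inj hP) ->.
  + by move/eqP; rewrite eq_sym (negbTE (h_neq_opp hP _ _)).
  + by move/eqP; rewrite (negbTE (h_neq_opp hP _ _)).
  by move/(h_inj hP) ->.
- by case: s; rewrite ?raddfN /= parity_unit_vec => /eqP; rewrite ?oppr_eq0 (negbTE (h_neq0 _)).
by case: t; rewrite ?raddfN /= parity_unit_vec => /esym/eqP; rewrite ?oppr_eq0 (negbTE (h_neq0 _)).
Qed.

Lemma parity_lee_inj : {in lee_sphere L &, injective parity}.
Proof. by move=> _ _ /lee_sphereP[o ->] /lee_sphereP[o' ->] /parity_lee_vec_inj ->. Qed.

Lemma lee_translate_inj p x y :
  x - p \in lee_sphere L -> y - p \in lee_sphere L -> parity x = parity y -> x = y.
Proof.
by move=> xp yp xy; apply/(addIr (- p))/parity_lee_inj => //; rewrite !raddfB /= xy.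
Qed.

Lemma card_lee_sphere : #|lee_sphere L| = q.
Proof.
have -> : lee_sphere L = [set lee_vec o | o : option (bool * 'I_n)].
  by apply/setP => x; apply/lee_sphereP/imsetP => [[o ->]|[o _ ->]]; exists o.
rewrite card_imset; last by move=> o o' eq_oo'; apply: parity_lee_vec_inj; rewrite /= eq_oo'.
by rewrite card_option card_prod card_bool card_ord mul2n (modulusE hP).
Qed.

(** * Cells of the torus labelled by Z_q *)

Definition fiber v : {set cube L} := [set x | parity x == v].

Lemma coset_fiber x : [set x + c | c in codewords L] = fiber (parity x).
Proof.
apply/setP => y; rewrite inE; apply/imsetP/eqP => [[c]|xy].
  by rewrite (codewordsE hP) => /eqP c0 ->; rewrite raddfD /= c0 addr0.
by exists (y - x); rewrite ?(codewordsE hP) ?raddfB /= ?xy ?subrr // addrC subrK.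
Qed.

(** The normalisation of [h] in the last direction provides a point of every parity. *)
Lemma parity_last v : parity (v *: unit_vec ord_max) = v.
Proof. by rewrite parityZ (h_last hP) mulr1. Qed.

Lemma fiber_vertices v : fiber v \in vertices L.
Proof.
by apply/imsetP; exists (v *: unit_vec ord_max); rewrite // coset_fiber parity_last.
Qed.

Definition vertex_of v : vertex L := exist _ (fiber v) (fiber_vertices v).

(** Parity is constant on a coset, so the point picked does not matter; cosets are nonempty, so the
    default 0 never occurs. *)
Definition vpos (B : vertex L) : Zq := parity (odflt 0 [pick y in val B]).

Lemma vertex_ofK : cancel vertex_of vpos.
Proof.
move=> v; rewrite /vpos; case: pickP => [y|/(_ (v *: unit_vec ord_max))] /=.
  by rewrite inE => /eqP.
by rewrite inE parity_last eqxx.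
Qed.

Lemma vposK : cancel vpos vertex_of.
Proof.
move=> B; have /imsetP[x _ Bx] := valP B.
have -> : B = vertex_of (parity x) by apply: val_inj; rewrite Bx coset_fiber.
by rewrite vertex_ofK.
Qed.

Lemma mem_vertex (B : vertex L) y : (y \in val B) = (parity y == vpos B).
Proof. by rewrite -{1}[B]vposK inE. Qed.

Lemma card_vertex : #|{: vertex L}| = q.
Proof. by rewrite (bij_eq_card (Bijective vposK vertex_ofK)) card_Zq. Qed.

(** In consecutive dimensions the direction sets differ by a single [i], so the shift is by nothing
    or by [unit_vec i]: the two facets of [G] orthogonal to [i]. *)
Lemma incidentP k (F : cell L k) (G : cell L k.+1) :
  reflect (exists i, [/\ i \in val G.2, val F.2 = val G.2 :\ i &
              vpos F.1 = vpos G.1 \/ vpos F.1 = vpos G.1 + h i])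
          (incident F G).
Proof.
have [cardF cardG] := (eqP (valP F.2), eqP (valP G.2)).
apply: (iffP andP) => [[subFG /existsP[K /andP[subK /exists_inP[y]]]]|].
  rewrite !mem_vertex raddfD raddf_sum /= => /eqP -> /eqP vF.
  have : #|val G.2 :\: val F.2| == 1%N.
    by rewrite cardsDS // cardF cardG subSn // subnn.
  case/cards1P => i GF; exists i.
  have i_GF : i \in val G.2 :\: val F.2 by rewrite GF set11.
  split; first by have /setDP[] := i_GF.
    by rewrite -GF setDDr setDv set0U; apply/esym/setIidPr.
  move: subK; rewrite GF subset1 => /orP[]/eqP KE; rewrite -vF KE.
    by right; rewrite big_set1 parity_unit_vec.
  by left; rewrite big_set0 addr0.
move=> [i [iG FE vF]]; split; first by rewrite FE subD1set.
have GF : val G.2 :\: val F.2 = [set i].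
  by rewrite FE setDDr setDv set0U; apply/setIidPr; rewrite sub1set.
apply/existsP; exists (if vpos F.1 == vpos G.1 then set0 else [set i]); apply/andP; split.
  by rewrite GF; case: ifP; rewrite ?sub0set.
apply/exists_inP; exists (vpos G.1 *: unit_vec ord_max); rewrite mem_vertex ?parity_last //.
rewrite raddfD /= parity_last; case: (vpos F.1 =P vpos G.1) vF => [-> _|neq [//|->]].
  by rewrite big_set0 raddf0 addr0.
by rewrite big_set1 parity_unit_vec.
Qed.

(* Cochains as functions of the least corner and of the directions of a cell. *)
Implicit Types a : Zq -> {set 'I_n} -> bool.

Definition coboundary a v A : bool := \sum_(i in A) (a v (A :\ i) + a (v + h i) (A :\ i)).

(** Summing over matching cells makes the value available for every set [A], without a proof of its
    cardinality; it is 0 when [#|A|] differs from [k]. *)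
Definition cochain k (b : bits (cell L k)) v A : bool :=
  \sum_(F : cell L k | (vpos F.1 == v) && (val F.2 == A)) b F.

Lemma cochainE k (b : bits (cell L k)) v (I : directions L k) :
  cochain b v (val I) = b (vertex_of v, I).
Proof.
rewrite /cochain (big_pred1 (vertex_of v, I)) // => -[B I'] /=.
by rewrite xpair_eqE (can2_eq vposK vertex_ofK) (inj_eq val_inj).
Qed.

(** As [h i] is nonzero, opposite facets are distinct cells, so no incidence is counted twice and
    cancelled modulo 2. *)
Lemma sum_incident k (G : cell L k.+1) (b : bits (cell L k)) :
  \sum_(F | incident F G) b F = coboundary (cochain b) (vpos G.1) (val G.2).
Proof.
transitivity (\sum_(i in val G.2) \sum_F
    ((vpos F.1 == vpos G.1) + (vpos F.1 == vpos G.1 + h i)) * (val F.2 == val G.2 :\ i) * b F).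
  rewrite exchange_big big_mkcond; apply: eq_bigr => F _.
  case: incidentP => [[i [iG FE vF]]|notFG].
    rewrite (bigD1 i) //= [X in _ + X]big1 ?addr0; last first.
      move=> j /andP[jG j_neq]; rewrite FE.
      case: (_ :\ i =P _ :\ j) => [/setP/(_ j)|_]; last by rewrite mulr0 mul0r.
      by rewrite !inE eqxx j_neq jG.
    have v_neq : vpos G.1 != vpos G.1 + h i.
      by rewrite -subr_eq0 opprD addNKr oppr_eq0 h_neq0.
    rewrite FE eqxx mulr1; case: vF => ->; rewrite eqxx ?(negbTE v_neq).
      by rewrite addr0 mul1r.
    by rewrite eq_sym (negbTE v_neq) add0r mul1r.
  rewrite big1 // => i iG; case: (val F.2 =P _) => [FE|_]; last by rewrite mulr0 mul0r.
  case: eqP => [vF|_]; first by case: notFG; exists i; split; [|rewrite FE|left].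
  case: eqP => [vF|_]; first by case: notFG; exists i; split; [|rewrite FE|right].
  by rewrite addr0 !mul0r.
rewrite /coboundary; apply: eq_bigr => i _.
have mkcond (Q : pred (cell L k)) : \sum_(F | Q F) b F = \sum_F (Q F : bool) * b F.
  by rewrite big_mkcond; apply: eq_bigr => F _; case: (Q F); rewrite ?mul1r ?mul0r.
rewrite /cochain !mkcond -big_split /=.
apply: eq_bigr => F _.
rewrite -mulrDl; congr (_ * _).
by case: (vpos F.1 == _) (vpos F.1 == _) (val F.2 == _) => [] [] [].
Qed.

Lemma eq_coboundary a a' v A :
  (forall u i, i \in A -> a u (A :\ i) = a' u (A :\ i)) ->
  coboundary a v A = coboundary a' v A.
Proof. by move=> eq_a; apply: eq_bigr => i iA; rewrite !eq_a. Qed.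

(** The ordered pairs (i, j) and (j, i) cancel modulo 2, which is why the square of [coboundary]
    vanishes without orientation signs. *)
Lemma sum_sym_offdiag (g : 'I_n -> 'I_n -> bool) A :
  (forall i j, g i j = g j i) -> \sum_(i in A) \sum_(j in A :\ i) g i j = 0.
Proof.
move=> g_sym.
have split_sum i : i \in A -> \sum_(j in A :\ i) g i j =
    \sum_(j in A | (i < j)%N) g i j + \sum_(j in A | (j < i)%N) g j i.
  move=> iA; rewrite (bigID (fun j : 'I_n => (i < j)%N)) /=; congr (_ + _).
    by apply: eq_bigl => j; rewrite !inE -val_eqE /=; case: ltngtP; rewrite ?andbT ?andbF.
  rewrite (eq_bigr (fun j => g j i)); last by move=> j _; apply: g_sym.
  by apply: eq_bigl => j; rewrite !inE -val_eqE /=; case: ltngtP; rewrite ?andbT ?andbF.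
rewrite (eq_bigr _ split_sum) big_split /=.
rewrite [X in _ + X](exchange_big_dep (mem A)) /=; last by move=> i j _ /andP[].
rewrite [X in _ + X](eq_bigr (fun i : 'I_n => \sum_(j in A | (i < j)%N) g i j)); first exact: addbb.
by move=> i iA; apply: eq_bigl => j; rewrite iA.
Qed.

Lemma coboundary2 a v A : coboundary (coboundary a) v A = 0.
Proof.
pose g i j := a v (A :\ i :\ j) + a (v + h j) (A :\ i :\ j) +
  (a (v + h i) (A :\ i :\ j) + a (v + h i + h j) (A :\ i :\ j)).
rewrite -[RHS](@sum_sym_offdiag g A); last first.
  move=> i j; rewrite /g; have -> : A :\ i :\ j = A :\ j :\ i.
    by apply/setP => k; rewrite !inE andbCA.
  rewrite [v + h i + h j]addrAC; ring.
by apply: eq_bigr => i _; rewrite -big_split.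
Qed.

Lemma directions_ex k A : #|A| = k -> exists I : directions L k, val I = A.
Proof. by move=> /eqP cardA; exists (exist (fun B : {set 'I_n} => #|B| == k) A cardA). Qed.

Lemma cochainD k (b c : bits (cell L k)) v A : cochain (b + c) v A = cochain b v A + cochain c v A.
Proof. by rewrite -big_split; apply: eq_bigr => F _; rewrite ffunE. Qed.

(** So the sigma_z conditions single out the 2-cocycles; as the edge stars span the coboundaries,
    logical labels are classes in the second cohomology modulo 2. *)
Lemma synd_cube_boundary (b : bits (face L)) c :
  synd (@cube_boundary L) b c = coboundary (cochain b) (vpos c.1) (val c.2).
Proof.
by rewrite ffunE dot_ind -sum_incident; apply: eq_bigl => f; rewrite inE.
Qed.

Lemma xorspan_edge_star (b : bits (cell L 1)) f :
  xorspan (@edge_star L) b f = coboundary (cochain b) (vpos f.1) (val f.2).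
Proof.
rewrite ffunE -sum_incident [RHS]big_mkcond; apply: eq_bigr => e _; rewrite inE.
by case: incident; rewrite ?mulr1 ?mulr0.
Qed.

Lemma cochain_edge_star (b : bits (cell L 1)) v (I : directions L 2) :
  cochain (xorspan (@edge_star L) b) v (val I) = coboundary (cochain b) v (val I).
Proof. by rewrite cochainE xorspan_edge_star vertex_ofK. Qed.

Lemma ind_edge_star e : ind (edge_star e) = xorspan (@edge_star L) (err (Some e)).
Proof.
apply/ffunP => f; rewrite !ffunE (bigD1 e) //= big1 => [|e' /negbTE e'_neq].
  by rewrite addr0 ffunE set11 mul1r.
by rewrite ffunE inE e'_neq mul0r.
Qed.

Definition logical (b : bits (face L)) : bits (directions L 2) :=
  [ffun I => \sum_v cochain b v (val I)].

(* The faces with given directions form both a cycle and a cocycle, and they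
   pair with themselves to [q], which is odd. *)
Definition sheets (t : bits (directions L 2)) : bits (face L) := [ffun f => t f.2].

(* Contraction along the last direction. The translation operator [T] in that
   direction satisfies [(T + T^3 + ... + T^(q-2)) (1 + T) = 1 + (1 + T + ... + T^(q-1))]
   modulo 2, so this is a chain homotopy from the identity to the averaging operator. *)
Definition contraction a v A : bool :=
  if ord_max \in A then 0 else \sum_(k < n) a (v + (k.*2.+1)%:R) (ord_max |: A).

Definition contract (b : bits (face L)) : bits (cell L 1) :=
  [ffun e => contraction (cochain b) (vpos e.1) (val e.2)].

(** Since [q = 2n + 1], the [n] pairs of translates by 2k+1 and 2k+2 run through all nonzero
    residues; adding [g v] completes the sum. *)
Lemma sum_translates (g : Zq -> bool) v :
  \sum_(k < n) (g (v + (k.*2.+1)%:R) + g (v + (k.*2.+1)%:R + 1)) = g v + \sum_u g u.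
Proof.
have odd_even (g' : nat -> bool) m :
    \sum_(k < m) (g' k.*2.+1 + g' k.*2.+2) = g' 0%N + \sum_(k < m.*2.+1) g' k.
  elim: m => [|m IH]; first by rewrite big_ord0 big_ord1; apply/esym/addbb.
  by rewrite big_ord_recr IH doubleS [in RHS]big_ord_recr [in RHS]big_ord_recr /= -!addrA.
transitivity (\sum_(k < n) (g (v + (k.*2.+1)%:R) + g (v + (k.*2.+2)%:R))).
  by apply: eq_bigr => k _; rewrite -addrA natr1.
rewrite (odd_even (fun k => g (v + k%:R))) addr0; congr (_ + _).
rewrite [RHS](reindex_inj (addrI v)) /=.
transitivity (\sum_(k < (Zp_trunc q).+2) g (v + k%:R)).
  have eq_sum (m m' : nat) (G : nat -> bool) : m = m' -> \sum_(k < m) G k = \sum_(k < m') G k.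
    by move=> ->.
  by apply: (eq_sum _ _ (fun k => g (v + k%:R))); rewrite -card_Zq ?card_ord // (modulusE hP).
by apply: eq_bigr => u _; rewrite natr_Zp.
Qed.

(** The homotopy formula has one more term, the contraction of the coboundary of [a], which is zero
    for a cocycle. *)
Lemma contraction_homotopy a v A : #|A| = 2%N ->
  (forall u (B : {set 'I_n}), #|B| = 3%N -> coboundary a u B = 0) ->
  \sum_u a u A = a v A + coboundary (contraction a) v A.
Proof.
move=> cardA a_cocycle; pose z : 'I_n := ord_max.
have self_add (x y : bool) : y = x + (x + y) by case: x; case: y.
suff -> : coboundary (contraction a) v A = a v A + \sum_u a u A by apply: self_add.
rewrite -(sum_translates (a^~ A)); have [zA|zA] := boolP (z \in A).
  (* Removing any direction other than [z] leaves a set containing [z], where the contraction is 0;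
     only the term of [z] remains. *)
  rewrite /coboundary (bigD1 z) //= [X in _ + X]big1 ?addr0; last first.
    move=> i /andP[_ i_neq]; rewrite /contraction !inE eq_sym (negbTE i_neq) zA; exact: addbb.
  rewrite /contraction !inE eqxx /= setD1K // (h_last hP) -big_split.
  by apply: eq_bigr => k _; rewrite [v + 1 + _]addrAC.
transitivity (\sum_(i in A) \sum_(k < n) (a (v + (k.*2.+1)%:R) (z |: (A :\ i)) +
    a (v + (k.*2.+1)%:R + h i) (z |: (A :\ i)))).
  apply: eq_bigr => i iA; rewrite /contraction !inE (negbTE zA) andbF -big_split.
  by apply: eq_bigr => k _; rewrite [v + h i + _]addrAC.
rewrite exchange_big; apply: eq_bigr => k _; set u := v + _.
(* The cocycle relation on [z |: A] trades the terms of the directions in [A] for the term of [z],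
   which is [a u A + a (u + 1) A]. *)
have := a_cocycle u (z |: A); rewrite cardsU1 zA cardA => /(_ (erefl _)).
rewrite /coboundary big_setU1 //= setU1K // (h_last hP).
set s := _ + a (u + 1) A; rewrite (eq_bigr (fun i => a u (z |: (A :\ i)) + a (u + h i) (z |: (A :\ i)))).
  by set s' := \sum_(i in A) _; case: s; case: s'.
move=> i iA; have -> // : (z |: A) :\ i = z |: (A :\ i).
apply/setP => j; rewrite !inE; have [->|//] := eqVneq j z.
by rewrite andbT; apply: contraNneq zA => ->.
Qed.

Lemma toric_logical_basis :
  logical_basis (@edge_star L) (@cube_boundary L) logical sheets contract.
Proof.
split.
- move=> e; apply/ffunP => c; rewrite synd_cube_boundary ind_edge_star.
  rewrite (eq_coboundary (a' := coboundary (cochain (err (Some e))))) ?coboundary2 ?ffunE //.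
  move=> u i ic; have [I <-] := directions_ex (card_D1 ic (eqP (valP c.2))).
  exact: cochain_edge_star.
- move=> e b; apply/ffunP => I; rewrite !ffunE.
  under eq_bigr do rewrite cochainD ind_edge_star cochain_edge_star.
  rewrite big_split /= -[RHS]addr0; congr (_ + _).
  (* Over all [v] a function and its translate by [h i] have the same sum, so a coboundary has zero
     average. *)
  rewrite exchange_big big1 // => i _.
  rewrite big_split /=. 
  by rewrite [X in X + _](reindex_inj (addIr (h i))) /=; apply: addbb.
- move=> t; apply/ffunP => c; rewrite synd_cube_boundary ffunE; apply: big1 => i ic.
  have [I <-] := directions_ex (card_D1 ic (eqP (valP c.2))).
  by rewrite !cochainE !ffunE; apply: addbb.
- move=> t; apply/ffunP => I; rewrite ffunE.
  under eq_bigr do rewrite cochainE ffunE /=.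
  (* Of the [q] equal terms an even number cancels and, [q] being odd, one is left. *)
  rewrite sumr_const card_Zq (modulusE hP) mulrS -mul2n mulrnA.
  by rewrite [_ *+ 2]addbb mul0rn addr0.
move=> b b0; apply/ffunP => -[B I].
rewrite [LHS]ffunE [LHS]ffunE bitsE xorspan_edge_star /=.
rewrite (contraction_homotopy (vpos B) (eqP (valP I))); last first.
  move=> u A cardA; have [K <-] := directions_ex cardA.
  have /ffunP/(_ (vertex_of u, K)) := b0.
  by rewrite synd_cube_boundary /= vertex_ofK ffunE.
rewrite cochainE vposK; congr (_ + _); apply: eq_coboundary => u i iI.
have [K <-] := directions_ex (card_D1 iI (eqP (valP I))).
by rewrite cochainE ffunE /= vertex_ofK.
Qed.

(** Two opposite edges of a face have labels differing by [h i]. If another face contains both, they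
    are opposite edges of it too, so [h i] is [h j] or [- h j]; the second is excluded and the first
    forces the same corner and directions. *)
Lemma edge_syndromes_inj : injective (fun o => synd (@edge_star L) (err o)).
Proof.
apply: synd_err_inj => [[B I]|[B I] [B' I'] sub_edges].
  have /card_gt0P[i iI] : (0 < #|val I|)%N by rewrite (eqP (valP I)).
  have [K KE] := directions_ex (card_D1 iI (eqP (valP I))).
  by exists (B, K); rewrite inE; apply/incidentP; exists i; split; rewrite ?KE //; left.
have /card_gt0P[i iI] : (0 < #|val I|)%N by rewrite (eqP (valP I)).
have [K KE] := directions_ex (card_D1 iI (eqP (valP I))).
have /(sub_edges (B, K)) : (B, I) \in edge_star (B, K).
  by rewrite inE; apply/incidentP; exists i; split; rewrite ?KE //; left.
rewrite inE => /incidentP[/= j [jI' KE' vB]].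
pose B1 := vertex_of (vpos B + h i).
have /(sub_edges (B1, K)) : (B, I) \in edge_star (B1, K).
  by rewrite inE; apply/incidentP; exists i; split; rewrite ?KE //; right; rewrite vertex_ofK.
rewrite inE => /incidentP[/= j' [j'I' KE'' vB1]].
have jj' : j' = j.
  apply/eqP; move: jI'; apply: contraTT => jj'; have := setD11 j (val I').
  by rewrite -KE' KE'' !inE eq_sym jj' => /= ->.
move: vB1; rewrite {}jj' vertex_ofK => vB1.
have [vBB' ij] : vpos B = vpos B' /\ i = j.
  case: vB vB1 => -> [/eqP|].
  - by rewrite addrC -subr_eq0 addrK (negbTE (h_neq0 _)).
  - by move/addrI/(h_inj hP) ->.
  - by rewrite -addrA addrC -subr_eq0 addrK addrC addr_eq0 (negbTE (h_neq_opp hP _ _)).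
  by move/eqP; rewrite addrC -subr_eq0 addrK (negbTE (h_neq0 _)).
congr (_, _); first exact: (can_inj vposK).
by apply: val_inj; rewrite -(setD1K iI) (etrans (esym KE) KE') ij setD1K.
Qed.

(** Dual argument, with the two three-dimensional cubes on either side of a face in a direction [c]
    outside it; a third dimension supplies [c]. *)
Lemma cube_syndromes_inj : (2 < n)%N -> injective (fun o => synd (@cube_boundary L) (err o)).
Proof.
move=> n_gt2.
have corner (f : face L) : exists2 c, c \notin val f.2 & exists K : directions L 3, val K = c |: val f.2.
  have /subsetPn[c _ cI] : ~~ ([set: 'I_n] \subset val f.2).
    apply: contraL n_gt2 => /subset_leq_card; rewrite cardsT card_ord (eqP (valP f.2)).
    by rewrite leqNgt.
  by exists c => //; apply: directions_ex; rewrite cardsU1 cI (eqP (valP f.2)).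
apply: synd_err_inj => [f|f f' sub_cubes]; have [c cI [K KE]] := corner f.
  exists (f.1, K); rewrite inE; apply/incidentP; exists c; rewrite /= KE setU11 setU1K //.
  by split=> //; left.
have /(sub_cubes (f.1, K)) : f \in cube_boundary (f.1, K).
  rewrite inE; apply/incidentP; exists c; rewrite /= KE setU11 setU1K //.
  by split=> //; left.
rewrite inE => /incidentP[/= j [jK I'E vB]].
pose B1 := vertex_of (vpos f.1 - h c).
have /(sub_cubes (B1, K)) : f \in cube_boundary (B1, K).
  rewrite inE; apply/incidentP; exists c; rewrite /= KE setU11 setU1K //.
  by split=> //; right; rewrite vertex_ofK subrK.
rewrite inE => /incidentP[/= j' [j'K I'E' vB1]].
have jj' : j' = j.
  apply/eqP; move: jK; apply: contraTT => jj'; have := setD11 j (val K).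
  by rewrite -I'E I'E' !inE eq_sym jj' => /= ->.
move: vB1; rewrite {}jj' vertex_ofK => vB1.
have [vff' jc] : vpos f.1 = vpos f'.1 /\ j = c.
  case: vB vB1 => [->|->] [/eqP|/eqP].
  - by rewrite -subr_eq0 subKr (negbTE (h_neq0 _)).
  - by rewrite eq_sym -addrA addrC -subr_eq0 addrK addrC subr_eq0 => /eqP/(h_inj hP).
  - by rewrite (inj_eq (addrI _)) (negbTE (h_neq_opp hP _ _)).
  by rewrite (inj_eq (addIr _)) -subr_eq0 subKr (negbTE (h_neq0 _)).
rewrite [f]surjective_pairing [f']surjective_pairing; congr (_, _).
  exact: (can_inj vposK).
by apply: val_inj; rewrite /= I'E jc KE setU1K.
Qed.

End Parity.
End Lattice.

(** * Placement of the copies *)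

(** Two defaults occur because [placement] takes the directions of the qubit at hand as default;
    both indices are in range. *)
Lemma nth_divmod_inj (T1 T2 : eqType) (s1 : seq T1) (s2 : seq T2) x0 y0 y1 N m m' :
  uniq s1 -> uniq s2 -> size s1 = N -> (m < size s2 * N)%N -> (m' < size s2 * N)%N ->
  nth x0 s1 (m %% N) = nth x0 s1 (m' %% N) -> nth y0 s2 (m %/ N) = nth y1 s2 (m' %/ N) ->
  m = m'.
Proof.
move=> uniq1 uniq2 sz1 m_lt m'_lt eq1 eq2.
have N_gt0 : (0 < N)%N by case: N m_lt {sz1 m'_lt eq1 eq2} => //; rewrite muln0.
have eq_mod : (m %% N = m' %% N)%N.
  by apply/eqP; rewrite -(nth_uniq x0 _ _ uniq1) ?sz1 ?ltn_mod // eq1.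
have eq_div : (m %/ N = m' %/ N)%N.
  apply/eqP; rewrite -(nth_uniq y0 _ _ uniq2) ?ltn_divLR // eq2.
  by rewrite (set_nth_default y0) // ltn_divLR.
by rewrite (divn_eq m N) eq_mod eq_div -divn_eq.
Qed.

Section Placement.
Variables (L : lattice_code) (h : 'I_(nD L) -> 'Z_(modulus L)).
Local Notation q := (modulus L).
Local Notation n := (nD L).
Local Notation Zq := 'Z_(modulus L).

Record generators : Prop := Generators {
  encode_inj : injective (@encode L);
  codewords_encode : forall c, c \in codewords L <-> exists a, c = encode a;
  section_onto : exists2 c, c \in codewords L & cross_section c = 1 }.

Hypotheses (hP : parity_check h) (gP : generators).

Lemma card_codewords : #|codewords L| = (q ^ n.-1)%N.
Proof.
have -> : codewords L = [set encode a | a : 'rV_(ngens L)].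
  apply/setP => c; apply/idP/imsetP => [/(codewords_encode gP)[a ->]|[a _ ->]]; first by exists a.
  by apply/(codewords_encode gP); exists a.
rewrite card_imset; last exact: encode_inj.
by rewrite card_mx mul1n (card_Zq hP).
Qed.

Lemma card_codeword : #|{: codeword L}| = (q ^ n.-1)%N.
Proof. by rewrite card_sig -card_codewords; apply: eq_card => c; rewrite inE. Qed.

Lemma card_directions k : #|{: directions L k}| = 'C(n, k).
Proof. by rewrite card_sig -[n in RHS]card_ord -card_draws cardsE. Qed.

Lemma card_face : #|{: face L}| = ('C(n, 2) * q)%N.
Proof. by rewrite card_prod (card_vertex hP) card_directions mulnC. Qed.

Lemma card_position : #|{: position L}| = ('C(n, 2) * q ^ n)%N.
Proof. by rewrite card_prod card_directions card_mx mul1n (card_Zq hP) mulnC. Qed.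

Lemma codewordsD c c' : c \in codewords L -> c' \in codewords L -> c + c' \in codewords L.
Proof. by rewrite !(codewordsE hP) raddfD /= => /eqP-> /eqP->; rewrite addr0. Qed.

(** Translation by a multiple of a codeword with first coordinate 1 carries any cross-section into
    any other, so all have the same size. *)
Lemma card_section j :
  (q * #|[set c in codewords L | cross_section c == j]|)%N = (q ^ n.-1)%N.
Proof.
have [c1 c1C c1_1] := section_onto gP.
have parityZc (v : Zq) x : parity h (v *: x) = v * parity h x.
  by rewrite /parity mulr_sumr; apply: eq_bigr => i _; rewrite mxE mulrA.
have zc1C v : v *: c1 \in codewords L.
  by move: c1C; rewrite !(codewordsE hP) parityZc => /eqP->; rewrite mulr0.
have le_section i k : (#|[set c in codewords L | cross_section c == i]| <=
                       #|[set c in codewords L | cross_section c == k]|)%N.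
  rewrite -(card_imset _ (addIr ((k - i) *: c1))); apply/subset_leq_card/subsetP => _ /imsetP[c + ->].
  rewrite !inE => /andP[cC /eqP ci]; rewrite codewordsD //= /cross_section !mxE.
  by rewrite -!/(cross_section _) ci c1_1 mulr1 addrC subrK.
rewrite -card_codewords -[in RHS]sum1_card (partition_big (@cross_section L) xpredT) //=.
rewrite (eq_bigr (fun=> #|[set c in codewords L | cross_section c == j]|)); last first.
  by move=> k _; rewrite sum1dep_card; apply/eqP; rewrite eqn_leq !le_section.
by rewrite sum_nat_const (card_Zq hP).
Qed.

Section Interleaved.
Variables (coefs : seq 'rV[Zq]_(ngens L)) (spheres : seq (cube L)).
Variables (faces : seq (face L)) (slots : seq (directions L 2)).
Hypotheses (coefsE : perm_eq coefs (enum {: 'rV[Zq]_(ngens L)}))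
  (spheresE : perm_eq spheres (enum (lee_sphere L)))
  (facesE : perm_eq faces (enum {: face L}))
  (slotsE : perm_eq slots (enum {: directions L 2})).
Local Notation codes := [seq encode a | a <- coefs].
Local Notation place := (placement codes spheres faces slots).

Lemma size_codes : size codes = (q ^ n.-1)%N.
Proof. by rewrite size_map (perm_size coefsE) -cardE card_mx mul1n (card_Zq hP). Qed.

Lemma uniq_codes : uniq codes.
Proof. by rewrite (map_inj_uniq (encode_inj gP)) (perm_uniq coefsE) enum_uniq. Qed.

Lemma mem_codes c : (c \in codes) = (c \in codewords L).
Proof.
apply/mapP/idP => [[a _ ->]|/(codewords_encode gP)[a ->]].
  by apply/(codewords_encode gP); exists a.
by exists a; rewrite // (perm_mem coefsE) mem_enum.
Qed.

Lemma codewords_gt0 : (0 < q ^ n.-1)%N.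
Proof. by rewrite expn_gt0 (modulusE hP). Qed.

Lemma size_section_qubits j :
  size (section_qubits codes faces j) = ('C(n, 2) * q ^ n.-1)%N.
Proof.
rewrite size_allpairs (perm_size facesE) -cardE card_face.
rewrite -(card_section j) mulnCA; congr (_ * _)%N.
rewrite mulnC; congr (_ * _)%N; rewrite -(card_uniqP (filter_uniq _ uniq_codes)).
by apply: eq_card => c; rewrite inE mem_filter mem_codes andbC.
Qed.

Lemma index_lt (c : codeword L) f :
  (index (val c, f) (section_qubits codes faces (cross_section (val c))) < 'C(n, 2) * q ^ n.-1)%N.
Proof.
rewrite -(size_section_qubits (cross_section (val c))) index_mem; apply: allpairs_f.
  by rewrite mem_filter eqxx mem_codes (valP c).
by rewrite (perm_mem facesE) mem_enum.
Qed.

Lemma parity_place (c : codeword L) f :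
  parity h (place (c, f)).1 = parity h (nth 0 spheres (cross_section (val c))).
Proof.
rewrite /= raddfD /=; set r := (_ %% _)%N.
have : nth 0 codes r \in codewords L.
  by rewrite -mem_codes mem_nth // size_codes ltn_mod codewords_gt0.
by rewrite (codewordsE hP) => /eqP ->; rewrite add0r.
Qed.

(** The parity of the cube reveals [s_j], hence the cross-section [j]. Then codeword and slot give
    the remainder and quotient of the qubit number, which determines the qubit in the list of that
    section. *)
Lemma placement_inj : injective place.
Proof.
move=> [c f] [c' f'] eq_place.
have size_spheres : size spheres = q by rewrite (perm_size spheresE) -cardE (card_lee_sphere hP).
have lt_q (j : Zq) : (j < q)%N by have := ltn_ord j; rewrite [X in (_ < X)%N -> _]Zp_cast // (modulusE hP).
have mem_spheres (j : Zq) : nth 0 spheres j \in lee_sphere L.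
  by rewrite -mem_enum -(perm_mem spheresE) mem_nth // size_spheres.
have eq_s : nth 0 spheres (cross_section (val c)) = nth 0 spheres (cross_section (val c')).
  by apply: (parity_lee_inj hP) => //; rewrite -(parity_place c f) -(parity_place c' f') eq_place.
have eq_j : cross_section (val c) = cross_section (val c').
  apply/val_inj/eqP; rewrite -(nth_uniq 0 (s := spheres)) ?eq_s ?size_spheres ?lt_q //.
  by rewrite (perm_uniq spheresE) enum_uniq.
have := index_lt c f; have := index_lt c' f'; rewrite -eq_j.
case: eq_place; rewrite -!/(placement _ _ _ _ _) -eq_j.
set m := index _ _; set m' := index _ _ => /addIr eq_r eq_slot m'_lt m_lt.
have size_slots : size slots = 'C(n, 2) by rewrite (perm_size slotsE) -cardE card_directions.
have uniq_slots : uniq slots by rewrite (perm_uniq slotsE) enum_uniq.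
rewrite -size_slots in m_lt m'_lt.
have := nth_divmod_inj uniq_codes uniq_slots size_codes m_lt m'_lt eq_r eq_slot.
have mem_c (d : codeword L) e : cross_section (val d) = cross_section (val c) ->
    (val d, e) \in section_qubits codes faces (cross_section (val c)).
  move=> dc; apply: allpairs_f; first by rewrite mem_filter dc eqxx mem_codes (valP d).
  by rewrite (perm_mem facesE) mem_enum.
move=> eq_m; have [/val_inj -> -> //] : (val c, f) = (val c', f').
rewrite -(nth_index (val c, f) (mem_c c f (erefl _))).
rewrite -[RHS](nth_index (val c, f) (mem_c c' f' (esym eq_j))).
exact: congr1 eq_m.
Qed.

Lemma lee_burst_single T (c : codeword L) : lee_burst T -> (#|[set f | place (c, f) \in T]| <= 1)%N.
Proof.
case=> p [T_sphere T_single]; apply/card_le1_eqP => f f'; rewrite !inE => fT f'T.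
have eq_parity := etrans (parity_place c f) (esym (parity_place c f')).
have eq_cube := lee_translate_inj hP (T_sphere _ fT) (T_sphere _ f'T) eq_parity.
have [//] := placement_inj (T_single _ _ fT f'T eq_cube).
Qed.

End Interleaved.
End Placement.

(** * Dimension and decoding of the interleaved code *)

Section InterleavedToricCode.
Variables (C : numClosedFieldType) (L : lattice_code) (h : 'I_(nD L) -> 'Z_(modulus L)).
Hypotheses (hP : parity_check h) (gP : generators L) (n_gt2 : (2 < nD L)%N).
Local Notation n := (nD L).
Local Notation q := (modulus L).

Lemma dim_toric_code : \dim (toric_code L C) = (2 ^ 'C(n, 2))%N.
Proof.
by rewrite (dim_stabilizer_code C (toric_logical_basis hP)) card_ffun card_bool card_directions.
Qed.

Definition toric_decoder := syndrome_decoder C (@edge_star L) (@cube_boundary L).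

Lemma toric_decoder_corrects : corrects toric_decoder (toric_code L C) (fun T => #|T| <= 1)%N.
Proof.
exact: (syndrome_decoder_corrects C (edge_syndromes_inj hP) (cube_syndromes_inj hP n_gt2)).
Qed.

Variables (coefs : seq 'rV['Z_q]_(ngens L)) (spheres : seq (cube L)).
Variables (faces : seq (face L)) (slots : seq (directions L 2)).
Hypotheses (coefsE : perm_eq coefs (enum {: 'rV['Z_q]_(ngens L)}))
  (spheresE : perm_eq spheres (enum (lee_sphere L)))
  (facesE : perm_eq faces (enum {: face L}))
  (slotsE : perm_eq slots (enum {: directions L 2})).
Local Notation place := (placement [seq encode a | a <- coefs] spheres faces slots).

Lemma placement_bij : bijective place.
Proof.
apply: inj_card_bij (placement_inj hP gP coefsE spheresE facesE slotsE) _.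
rewrite (card_position hP) card_prod (card_face hP) (card_codeword hP gP).
by rewrite mulnCA -expnSr.
Qed.

Lemma dim_interleaved_code :
  \dim (copies_code C place (@edge_star L) (@cube_boundary L)) = (2 ^ ('C(n, 2) * q ^ n.-1))%N.
Proof.
have [unplace placeK unplaceK] := placement_bij.
rewrite (dim_stabilizer_code C (copies_logical_basis placeK unplaceK (toric_logical_basis hP))).
by rewrite !card_ffun card_bool card_directions (card_codeword hP gP) -expnM.
Qed.

Lemma interleaved_decoder_corrects :
  corrects (decode_copies place toric_decoder)
    (copies_code C place (@edge_star L) (@cube_boundary L)) (@lee_burst L).
Proof.
have [unplace placeK unplaceK] := placement_bij.
have [tp corr] := decode_copies_corrects placeK unplaceK toric_decoder_corrects.
split=> // T E T_burst; apply: corr => c.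
exact: (lee_burst_single hP gP coefsE spheresE facesE slotsE c T_burst).
Qed.

End InterleavedToricCode.

(** * The two lattice codes *)

Section MinDistance.
Variables (L : lattice_code) (hs : seq nat).
Local Notation n := (nD L).
Local Notation q := (modulus L).

(** Words are lists of natural numbers so that the exhaustive check evaluates under [vm_compute]. *)
Fixpoint all_words (b m : nat) (P : seq nat -> bool) : bool :=
  if m is m'.+1 then all (fun x => all_words b m' (fun s => P (x :: s))) (iota 0 b) else P [::].

Lemma all_wordsP b m P s :
  all_words b m P -> size s = m -> all (fun x => x < b)%N s -> P s.
Proof.
elim: m P s => [|m IH] P [|x s] //= /allP words [size_s] /andP[x_lt s_lt].
by apply: (IH (fun s => P (x :: s))) => //; apply: words; rewrite mem_iota.
Qed.

Definition heavy (s : seq nat) : bool :=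
  (q %| sumn [seq nth 0 s k * nth 0 hs k | k <- iota 0 n])%N ==>
    (all (pred1 0%N) s || (2 < sumn [seq minn x (q - x) | x <- s])%N).

Lemma mannheim_weight_ge3 (c : cube L) :
  parity_check (fun i : 'I_n => (nth 0%N hs i)%:R : 'Z_q) -> all_words q n heavy ->
  c \in codewords L -> c != 0 -> (2 < mannheim_weight c)%N.
Proof.
move=> hP checked; rewrite (codewordsE hP) => c_par c_neq0.
have q_gt1 : (1 < q)%N by rewrite (modulusE hP).
pose s := [seq val (c ord0 i) | i <- enum 'I_n].
have size_s : size s = n by rewrite size_map size_enum_ord.
have nth_s (i : 'I_n) : nth 0%N s i = val (c ord0 i).
  by rewrite (nth_map i) ?size_enum_ord // nth_ord_enum.
have s_lt : all (fun x => x < q)%N s.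
  by apply/allP => _ /mapP[i _ ->]; rewrite -[X in (_ < X)%N](card_Zq hP) card_ord ltn_ord.
have := all_wordsP checked size_s s_lt; rewrite /heavy.
have -> : (q %| sumn [seq nth 0 s k * nth 0 hs k | k <- iota 0 n])%N.
  rewrite sumnE big_map -[iota 0 n]/(index_iota 0 n) big_mkord.
  move: c_par; rewrite /parity (eq_bigr (fun i : 'I_n => (nth 0 s i * nth 0 hs i)%N%:R)); last first.
    by move=> i _; rewrite natrM nth_s natr_Zp.
  by rewrite -natr_sum => /eqP/(congr1 val) /=; rewrite val_Zp_nat // => /eqP.
rewrite /= sumnE big_map big_map big_enum /=; case/orP => // /allP s0.
case/eqP: c_neq0; apply/rowP => i; apply/val_inj; rewrite [in RHS]mxE; apply/eqP.
by apply: (s0 (val (c ord0 i))); apply: (map_f (fun i => val (c ord0 i))); rewrite mem_enum.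
Qed.

End MinDistance.

Lemma heavy3 : all_words 7 3 (heavy lattice_code3 [:: 5; 3; 1]%N).
Proof. by vm_compute. Qed.

Lemma heavy4 : all_words 9 4 (heavy lattice_code4 [:: 7; 5; 3; 1]%N).
Proof. by vm_compute. Qed.

(** * Matrix certificates for the parity checks *)

Section Certificate.
Variables (L : lattice_code) (hs : seq nat).
Local Notation Zq := 'Z_(modulus L).

Definition hvec (i : 'I_(nD L)) : Zq := (nth 0%N hs i)%:R.
Definition hcol : 'cV[Zq]_(nD L) := \col_i hvec i.
Definition zmx m k (s : seq (seq int)) : 'M[Zq]_(m, k) := map_mx intr (mx_of_rows m k s).

Local Notation A := (map_mx intr (lattice_mx L) : 'M[Zq]_(nD L)).
Local Notation G := (map_mx intr (gens_mx L) : 'M[Zq]_(ngens L, nD L)).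

(* [dec] reads the coefficients of a codeword off its coordinates, [emb] expresses
   the generators of the code in the rows of the lattice matrix. *)
Record parity_certificate (dec emb : seq (seq int)) : Prop := ParityCertificate {
  lattice_parity : A *m hcol = 0;
  gens_lattice : zmx (ngens L) (nD L) emb *m A = G;
  gens_dec : G *m zmx (nD L) (ngens L) dec = 1%:M;
  dec_gens : zmx (nD L) (ngens L) dec *m G + hcol *m delta_mx ord0 ord_max = 1%:M }.

Variables dec emb : seq (seq int).
Hypothesis cert : parity_certificate dec emb.

Lemma parity_hcol (x : cube L) : x *m hcol = (parity hvec x)%:M.
Proof.
rewrite [LHS]mx11_scalar mxE; congr (_%:M).
by apply: eq_bigr => i _; rewrite mxE.
Qed.

(** [dec_gens] splits [x] into a codeword and [parity x] times the last unit vector. *)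
Lemma parity_ker_encode (x : cube L) :
  parity hvec x = 0 -> x = encode (x *m zmx (nD L) (ngens L) dec).
Proof.
move=> x0; rewrite /encode -[LHS]mulmx1 -(dec_gens cert) mulmxDr !mulmxA.
by rewrite parity_hcol x0 raddf0 mul0mx addr0.
Qed.

Lemma encode_mem (a : 'rV[Zq]_(ngens L)) : encode a \in codewords L.
Proof. by apply/imsetP; exists (a *m zmx (ngens L) (nD L) emb); rewrite // -mulmxA (gens_lattice cert). Qed.

Lemma codewords_parity (x : cube L) : (x \in codewords L) = (parity hvec x == 0).
Proof.
apply/imsetP/eqP => [[u _ ->]|/parity_ker_encode ->]; last by apply/imsetP/encode_mem.
have : u *m A *m hcol = 0 by rewrite -mulmxA (lattice_parity cert) mulmx0.
by rewrite parity_hcol => /matrixP/(_ 0 0); rewrite !mxE.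
Qed.

Lemma certificate_generators : (0 < ngens L)%N ->
  (forall k : 'I_(ngens L), val k = (ngens L).-1 -> G k ord0 = 1) -> generators L.
Proof.
move=> ngens_gt0 last_row; split.
- move=> a b eq_ab; rewrite -[a]mulmx1 -[b]mulmx1 -(gens_dec cert) !mulmxA.
  by congr (_ *m _).
- move=> c; split=> [|[a ->]]; last exact: encode_mem.
  by rewrite codewords_parity => /eqP/parity_ker_encode ->; eexists.
have last_lt : ((ngens L).-1 < ngens L)%N by rewrite prednK.
exists (encode (delta_mx ord0 (Ordinal last_lt))); first exact: encode_mem.
by rewrite /cross_section /encode -rowE mxE last_row.
Qed.

End Certificate.

Ltac check_matrix :=
  apply/matrixP => -[[|[|[|[|?]]]] ?] [[|[|[|[|?]]]] ?] //; 
  rewrite !mxE !big_ord_recl !big_ord0 !mxE; apply/eqP; vm_compute.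

(** The vector (5, 3, 1) solves [A h = 0] modulo 7 and, with its negatives (2, 4, 6), exhausts the
    nonzero residues. The coefficients of a codeword are its second and first coordinates. *)
Lemma certificate3 : @parity_certificate lattice_code3 [:: 5; 3; 1]%N
  [:: [:: 0; 1]; [:: 1; 0]; [:: 0; 0]] [:: [:: 0; 1; 0]; [:: 0; 0; 1]].
Proof. by split; check_matrix. Qed.

(** Likewise (7, 5, 3, 1) and its negatives (2, 4, 6, 8) modulo 9. The coefficients are [x_3 - x_2],
    [x_2] and [x_1]; the generators are rows 1, 3 and 4 of the lattice matrix. *)
Lemma certificate4 : @parity_certificate lattice_code4 [:: 7; 5; 3; 1]%N
  [:: [:: 0; 0; 1]; [:: -1; 1; 0]; [:: 1; 0; 0]; [:: 0; 0; 0]]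
  [:: [:: 1; 0; 0; 0]; [:: 0; 0; 1; 0]; [:: 0; 0; 0; 1]].
Proof. by split; check_matrix. Qed.

Lemma parity_check3 : parity_check (@hvec lattice_code3 [:: 5; 3; 1]%N).
Proof.
split=> //.
- move=> [[|[|[|i]]] ?] [[|[|[|j]]] ?] //= /eqP; vm_compute => // _; exact: val_inj.
- by move=> [[|[|[|i]]] ?] [[|[|[|j]]] ?]; vm_compute.
- exact: codewords_parity certificate3.
Qed.

Lemma parity_check4 : parity_check (@hvec lattice_code4 [:: 7; 5; 3; 1]%N).
Proof.
split=> //.
- move=> [[|[|[|[|i]]]] ?] [[|[|[|[|j]]]] ?] //= /eqP; vm_compute => // _; exact: val_inj.
- by move=> [[|[|[|[|i]]]] ?] [[|[|[|[|j]]]] ?]; vm_compute.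
- exact: codewords_parity certificate4.
Qed.

Lemma generators3 : generators lattice_code3.
Proof.
apply: (certificate_generators certificate3) => // -[[|[|[|i]]] ?] //= _.
by rewrite !mxE.
Qed.

Lemma generators4 : generators lattice_code4.
Proof.
apply: (certificate_generators certificate4) => // -[[|[|[|[|i]]]] ?] //= _.
by rewrite !mxE.
Qed.

Lemma min_mannheim_distance3 : min_mannheim_distance lattice_code3 3.
Proof.
split; last by move=> c; apply: (mannheim_weight_ge3 parity_check3 heavy3).
(* The last generator (1, 0, 2) has weight 1 + 2. *)
exists (@encode lattice_code3 (delta_mx ord0 ord_max)); rewrite (encode_mem certificate3).
split=> //.
  apply/eqP => /rowP/(_ ord0); rewrite /encode -rowE !mxE; apply/eqP; vm_compute.
  by [].
rewrite /mannheim_weight !big_ord_recl big_ord0 /encode -!rowE !mxE.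
by vm_compute.
Qed.

Lemma min_mannheim_distance4 : min_mannheim_distance lattice_code4 3.
Proof.
split; last by move=> c; apply: (mannheim_weight_ge3 parity_check4 heavy4).
(* The last generator (1, 0, 0, 2) has weight 1 + 2. *)
exists (@encode lattice_code4 (delta_mx ord0 ord_max)); rewrite (encode_mem certificate4).
split=> //.
  apply/eqP => /rowP/(_ ord0); rewrite /encode -rowE !mxE; apply/eqP; vm_compute.
  by [].
rewrite /mannheim_weight !big_ord_recl big_ord0 /encode -!rowE !mxE.
by vm_compute.
Qed.

Theorem theorem5 (R : realType) (L : lattice_code)
    (hL : L = lattice_code3 \/ L = lattice_code4) :
  (* the toric code Q *)
  [/\ #|face L| = (alpha L * modulus L)%N,
      \dim (toric_code L R[i]) = (2 ^ alpha L)%N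
    & min_mannheim_distance L 3] /\
  (* the interleaved code *)
  forall (coefs : seq 'rV['Z_(modulus L)]_(ngens L)) (spheres : seq (cube L))
    (faces : seq (face L)) (slots : seq (directions L 2)),
  perm_eq coefs (enum {: 'rV['Z_(modulus L)]_(ngens L)}) -> nth 0 coefs 0 = 0 ->
  perm_eq spheres (enum (lee_sphere L)) -> nth 0 spheres 0 = 0 ->
  perm_eq faces (enum {: face L}) ->
  perm_eq slots (enum {: directions L 2}) ->
  let place := placement [seq encode a | a <- coefs] spheres faces slots in
  [/\ #|position L| = (alpha L * modulus L ^ nD L)%N,
      \dim (copies_code R[i] place (@edge_star L) (@cube_boundary L)) =
        (2 ^ (alpha L * modulus L ^ (nD L).-1))%N
    & exists (K : finType) (D : K -> operator R[i] (face L)),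
        corrects D (toric_code L R[i]) (fun T => (#|T| <= (3 - 1)./2)%N) /\
        corrects (decode_copies place D)
          (copies_code R[i] place (@edge_star L) (@cube_boundary L))
          (@lee_burst L)].
Proof.
(* All that depends on the particular matrices is gathered here; the rest is uniform in [L]. *)
have [h hP [gP n_gt2 alphaE dist]] : exists2 h : 'I_(nD L) -> 'Z_(modulus L), parity_check h &
    [/\ generators L, (2 < nD L)%N, alpha L = 'C(nD L, 2) & min_mannheim_distance L 3].
  case: hL => ->.
    exists (@hvec lattice_code3 [:: 5; 3; 1]%N); first exact: parity_check3.
    by split=> //; [apply: generators3 | apply: min_mannheim_distance3].
  exists (@hvec lattice_code4 [:: 7; 5; 3; 1]%N); first exact: parity_check4.
  by split=> //; [apply: generators4 | apply: min_mannheim_distance4].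
split; first by split; rewrite // alphaE ?(dim_toric_code _ hP) ?(card_face hP).
move=> coefs spheres faces slots coefsE _ spheresE _ facesE slotsE place.
split; rewrite ?alphaE.
- exact: card_position hP.
- exact: (dim_interleaved_code _ hP gP coefsE spheresE facesE slotsE).
(* Kraus operators are indexed by pairs of syndromes; the bound [(3 - 1)./2] computes to 1. *)
exists _, (@toric_decoder R[i] L); split.
  exact: (toric_decoder_corrects _ hP n_gt2).
exact: (interleaved_decoder_corrects _ hP gP n_gt2 coefsE spheresE facesE slotsE).
Qed.
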